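(* Let $G\in\{SU(2),SO(3)\}$. For $\mathbf{l}=(l_1,\ldots,l_N)\in\mathcal{L}^N$ and $L\in\mathcal{L}_G$ with $L+\sum_{i=1}^Nl_i\in\mathbb{Z}$, define $$\mathrm{Var}_{\mathbf{l}}=\sum_{i=1}^N\frac{l_i(l_i+1)}{3}.$$ If there exist $l_{\min},l_{\max}>0$ independent of $N$ such that $l_{\min}\le l_i\le l_{\max}$ for all $i=1,\ldots,N$, then for $L\ll\sqrt{\mathrm{Var}_{\mathbf{l}}}$, there holds for $N$ sufficiently large that $$\dim(V^{\mathbf{l},L})=\prod_{i=1}^N(2l_i+1)\left(\frac{2L+1}{2\sqrt{2\pi}\,(\mathrm{Var}_{\mathbf{l}})^{3/2}}+O\Big(\frac{1}{N^{5/2}}\Big)\right).$$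
   Context: Setting. $\mathcal{L}_{SU(2)}=\{0,\frac12,1,\frac32,\ldots\}$, $\mathcal{L}_{SO(3)}=\{0,1,2,\ldots\}$. For $\ell\in\mathcal{L}_G$, $\mathcal{M}_\ell=\{-\ell,-\ell+1,\ldots,\ell\}$ and $D^\ell$ is the Wigner-D matrix of degree $\ell$, i.e. the irreducible complex matrix representation of $G$ of dimension $2\ell+1$. $\mathcal{L}$ is an index set; every $l\in\mathcal{L}$ has a component $\ell\in\mathcal{L}_G$ (e.g. $l=\ell$ or $l=(n,\ell)$), and in arithmetic expressions and inequalities $l$ stands for its $\ell$-component. $G$ acts on a domain $\Omega$ and diagonally on $\Omega^N$. For each $l\in\mathcal{L}$, $\phi^l_m:\Omega\to\mathbb{F}$, $m\in\mathcal{M}_\ell$ ($\mathbb{F}$ a complex vector space, e.g. $\mathbb{C}$) are orthonormal functions with $\phi^l_m(Q\cdot r)=\sum_{m'\in\mathcal{M}_\ell}D^\ell_{m,m'}(Q)\phi^l_{m'}(r)$ for all $Q\in G$, $r\in\Omega$; $V^l$ is their span. For $\mathbf{l}\in\mathcal{L}^N$, $V^{\mathbf{l}}=\bigotimes_{i=1}^NV^{l_i}$, with basis the products $\prod_{i=1}^N\phi^{l_i}_{m_i}(r_i)$, and $V^{\mathbf{l},L}$ is the space of group-equivariant functions $F\in[V^{\mathbf{l}}]^{2L+1}$, i.e. with $F(Q\cdot R)=D^L(Q)F(R)$ for all $Q\in G$, $R\in\Omega^N$.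
   Formalization: L is fixed before N grows, and the constant in O(1/N^{5/2}) and the threshold on N may depend on L; a bound uniform over all L ≪ √Var is false, since the error has order L^3/N^{5/2} (e.g. l_i = 1, L ~ N^{1/4}). *)

(* Defs.v *)
From HB Require Import structures.
From mathcomp Require Import all_boot all_order all_algebra.
From mathcomp Require Import complex.
From mathcomp Require Import boolp classical_sets functions reals exp trigo.

Set Implicit Arguments.
Unset Strict Implicit.
Unset Printing Implicit Defensive.

Import Order.TTheory GRing.Theory Num.Theory.
Local Open Scope ring_scope.
Local Open Scope classical_set_scope.
Local Open Scope complex_scope.
Local Open Scope sesquilinear_scope.

(* Degrees are half-integers and are stored doubled: the natural number d
   stands for ell = d / 2.  The order m in {-ell, -ell + 1, ..., ell} is the
   ordinal j : 'I_d.+1 with m = j - ell, so that ell + m = j and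
   ell - m = d - j. *)
Definition ell_of (R : realType) (d : nat) : R := d%:R / 2.

Inductive rotgroup := SU2 | SO3.

Definition is_degree (G : rotgroup) (d : nat) : Prop :=
  match G with SU2 => True | SO3 => ~~ odd d end.

Definition SU2set (R : realType) : set 'M[R[i]]_2 :=
  [set U | U \is unitarymx /\ \det U = 1].

Definition SO3set (R : realType) : set 'M[R]_3 :=
  [set A | A *m A^T = 1%:M /\ \det A = 1].

Definition gfield (R : realType) (G : rotgroup) : fieldType :=
  match G with SU2 => R[i] | SO3 => R end.

Definition gsize (G : rotgroup) : nat :=
  match G with SU2 => 2 | SO3 => 3 end.

Definition gmx (R : realType) (G : rotgroup) : Type :=
  'M[gfield R G]_(gsize G).

Definition gset (R : realType) (G : rotgroup) : set (gmx R G) :=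
  match G with SU2 => @SU2set R | SO3 => @SO3set R end.

Definition group_action (R : realType) (G : rotgroup) (Omega : Type)
    (act : gmx R G -> Omega -> Omega) : Prop :=
  (forall r, act 1%:M r = r) /\
  (forall Q Q', gset Q -> gset Q' ->
     forall r, act (Q *m Q') r = act Q (act Q' r)).

(* Matrix of f |-> [(x, y) |-> f ((x, y) U)] on homogeneous polynomials of
   degree d = 2 ell in the normalized weight basis
     x^(ell + m) y^(ell - m) / sqrt ((ell + m)! (ell - m)!),
   dehomogenized at y = 1.  This is Wigner's formula; for d = 1 it is U itself,
   with m = +1/2 listed before m = -1/2. *)
Definition wignerSU2 (R : realType) (d : nat) (U : 'M[R[i]]_2) :
    'M[R[i]]_(d.+1) :=
  \matrix_(j < d.+1, k < d.+1)
    ((Num.sqrt ((j`! * (d - j)`!)%:R / (k`! * (d - k)`!)%:R : R))%:C *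
     ((U 0 0 *: 'X + (U 1 0)%:P) ^+ k *
      (U 0 1 *: 'X + (U 1 1)%:P) ^+ (d - k))`_j).

Definition pauli (R : realType) (j : 'I_3) : 'M[R[i]]_2 :=
  \matrix_(p < 2, q < 2)
    match (j : nat) with
    | 0%N => (p != q)%:R
    | 1%N => if p == q then 0 else if p == 0 then - 'i else 'i
    | _ => if p == q then (-1) ^+ p else 0
    end.

(* The double cover: U sigma_j U^* = \sum_k (spin_cover U) k j sigma_k. *)
Definition spin_cover (R : realType) (U : 'M[R[i]]_2) : 'M[R]_3 :=
  \matrix_(k < 3, j < 3)
    complex.Re (\tr (pauli R k *m U *m pauli R j *m U ^t*) / 2).

(* One of the two (opposite) preimages in SU(2) of a rotation. *)
Definition lift_rotation (R : realType) (A : 'M[R]_3) : 'M[R[i]]_2 :=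
  xget 0 [set U | SU2set U /\ spin_cover U = A].

(* On SO(3) this is only meaningful for even d, when wignerSU2 d takes the same
   value on U and - U. *)
Definition wignerD (R : realType) (G : rotgroup) (d : nat) :
    gmx R G -> 'M[R[i]]_(d.+1) :=
  match G with
  | SU2 => fun U => wignerSU2 d U
  | SO3 => fun A => wignerSU2 d (lift_rotation A)
  end.

(* H is the space of functions on which the inner product is defined, such as
   the square-integrable functions on Omega.  Definiteness is not required,
   because functions are not identified when equal almost everywhere. *)
Definition inner_product_on (R : realType) (V : lmodType R[i])
    (H : set V) (ip : V -> V -> R[i]) : Prop :=
  [/\ H 0,
      forall (a : R[i]) f g, H f -> H g -> H (a *: f + g),
      forall (a : R[i]) f g h, H f -> H g -> H h ->
        ip (a *: f + g) h = a * ip f h + ip g h,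
      forall f g, H f -> H g -> ip g f = (ip f g)^* &
      forall f, H f -> 0 <= ip f f].

(* F^{\otimes N}, realized inside the functions of N linear forms on F: the pure
   tensor of v is the multilinear form f |-> \prod_i f_i (v_i).  As linear forms
   separate the vectors of F, this identifies F^{\otimes N} with the span of
   the pure tensors; for F = C, evaluating at f_i = id gives the product of the
   numbers v_i. *)
Definition tensor_space (R : realType) (F : lmodType R[i]) (N : nat) :=
  ('I_N -> {scalar F}) -> R[i]^o.

Definition pure_tensor (R : realType) (F : lmodType R[i]) (N : nat)
    (v : 'I_N -> F) : tensor_space F N :=
  fun f => \prod_(i < N) f i (v i).

Definition product_function (R : realType) (F : lmodType R[i])
    (Omega I : Type) (deg : I -> nat)
    (phi : forall l : I, 'I_(deg l).+1 -> Omega -> F)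
    (N : nat) (l : 'I_N -> I)
    (m : {dffun forall i : 'I_N, 'I_(deg (l i)).+1}) :
    ('I_N -> Omega) -> tensor_space F N :=
  fun r => pure_tensor (fun i => phi (l i) (m i) (r i)).

Definition product_space (R : realType) (F : lmodType R[i])
    (Omega I : Type) (deg : I -> nat)
    (phi : forall l : I, 'I_(deg l).+1 -> Omega -> F)
    (N : nat) (l : 'I_N -> I) : set (('I_N -> Omega) -> tensor_space F N) :=
  [set f | exists c : {dffun forall i : 'I_N, 'I_(deg (l i)).+1} -> R[i],
     f = \sum_m c m *: product_function phi m].

Definition equivariant_space (R : realType) (G : rotgroup)
    (F : lmodType R[i]) (Omega I : Type)
    (act : gmx R G -> Omega -> Omega) (deg : I -> nat)
    (phi : forall l : I, 'I_(deg l).+1 -> Omega -> F)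
    (N : nat) (l : 'I_N -> I) (L : nat) :
    set ('I_L.+1 -> ('I_N -> Omega) -> tensor_space F N) :=
  [set f | (forall k, product_space phi l (f k)) /\
     forall Q, gset Q -> forall (r : 'I_N -> Omega) (k : 'I_L.+1),
       f k (fun i => act Q (r i)) = \sum_j wignerD L Q k j *: f j r].

Definition has_dimension (K : fieldType) (V : lmodType K) (W : set V)
    (n : nat) : Prop :=
  exists b : 'I_n -> V,
    (forall c : 'I_n -> K, \sum_i c i *: b i = 0 -> forall i, c i = 0) /\
    (forall v, W v <-> exists c : 'I_n -> K, v = \sum_i c i *: b i).

Definition Var (R : realType) (N : nat) (l : 'I_N -> R) : R :=
  \sum_(i < N) l i * (l i + 1) / 3.

(* Main.v *)
Require Import Defs.
From HB Require Import structures.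
From mathcomp Require Import all_boot all_order all_algebra.
From mathcomp Require Import complex.
From mathcomp Require Import boolp classical_sets functions reals exp trigo.
From mathcomp Require Import topology normedtype sequences.
From mathcomp Require Import constructive_ereal ereal.
From mathcomp Require Import derive realfun measure lebesgue_measure.
From mathcomp Require Import lebesgue_integral ftc gauss_integral.
From mathcomp Require Import ring lra zify.

Set Implicit Arguments.
Unset Strict Implicit.
Unset Printing Implicit Defensive.

Import Order.TTheory GRing.Theory Num.Theory.
Import numFieldNormedType.Exports.
Local Open Scope ring_scope.
Local Open Scope classical_set_scope.
Local Open Scope complex_scope.

(* Equivariant functions are the intertwiners between a tensor product of spin
   representations and D^L.  Differentiating along one-parameter curves turns
   equivariance into commutation with sl_2, and highest weight theory gives the
   dimension as A(L) - A(L+1), where A(w) counts the weight vectors of weight w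
   in the tensor product.

   On the Fourier side, with t = theta / 2, D = 2L and d_i = 2 l_i,
     A(L) - A(L+1) =
       (4/pi) \int_0^(pi/2) \prod_i chi_(d_i)(t) sin((D+1)t) sin t dt,
   and each normalized factor chi_d(t) / (d+1) equals exp (- 2 v_d t^2) up to
   O(t^4), where v_d = l(l+1)/3, and decays like exp (- c t^2) on [0, pi/2].
   Hence the product is Gaussian up to O(N t^4 exp (- c N t^2)), which gives an
   error O(N^(-5/2)), and the remaining Gaussian integral is the main term. *)

(** * Tensor products of matrices *)

(** Orthonormality makes the product functions linearly independent, so an equivariant function
    amounts to a coefficient matrix c with c T(U) = D(U) c, where T(U) is the tensor product of the
    Wigner matrices. From there on only matrices occur. The differentiation is algebraic. A
    one-parameter subgroup of SU(2) has trigonometric entries, but the curve with rows (1, x t) and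
    (y t, 1), where x y = -1 and the conjugate of y is - x, lies in SU(2) up to the factor (1 +
    t^2)^(-1/2). The parity of L + \sum d_i turns the resulting factors into integral powers of 1 +
    t^2. Commutation is then a polynomial identity, to be checked at natural t only and
    differentiated formally at 0. In the other direction, unipotent matrices act by polynomials in
    t. For SO(3) the Wigner matrix goes through a chosen lift to SU(2), and parity removes the sign
    of the lift. The analysis compares antiderivatives. This is why the error of the integrand is
    bounded by a multiple of 1 / (1 + c N t^2), whose antiderivative is an arctangent, and not by
    exponentials. *)

Section Tensor.
Variables (I : finType) (d : I -> nat).

Local Notation X := {dffun forall i : I, 'I_(d i).+1}.

(** Distributivity when the range of the inner sum depends on i; tagged pairs bring all ranges into
    one type, where the usual law applies. *)
Lemma prod_sum_dffun (K : comPzSemiRingType)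
    (A : forall i, 'I_(d i).+1 -> K) :
  \prod_i \sum_j A i j = \sum_(x : X) \prod_i A i (x i).
Proof.
rewrite (reindex (@dffun_of_fprod I (fun i => 'I_(d i).+1)));
  last exact/onW_bij/dffun_of_fprod_bij.
under [RHS]eq_bigr => t _.
  rewrite (eq_bigr (fun i => finfun (A i) (t i))); last first.
    by move=> i _; rewrite !ffunE.
  over.
rewrite (big_fprod _ _ (fun i => finfun (A i))).
rewrite -(bigA_distr_big_dep (fun i => tagged_with (fun i => 'I_(d i).+1) i)
  (fun i u => untag 0 (finfun (A i)) u)).
apply: eq_bigr => i _; rewrite -(big_tag (fun i => finfun (A i))).
by apply: eq_bigr => j _; rewrite ffunE.
Qed.

Definition tens (K : comNzRingType) (A : forall i, 'M[K]_((d i).+1)) :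
    'M[K]_#|{: X}| :=
  \matrix_(a, b) \prod_i A i ((enum_val a : X) i) ((enum_val b : X) i).

Definition slot (K : comNzRingType) (A B : forall i, 'M[K]_((d i).+1)) (i : I) :
    forall k, 'M[K]_((d k).+1) :=
  fun k => if k == i then A k else B k.

(** The derivative of [tens] at the identity: a Lie algebra acts on a tensor product by the sum of
    its actions in the single slots. *)
Definition tsum (K : comNzRingType) (A : forall i, 'M[K]_((d i).+1)) :
    'M[K]_#|{: X}| :=
  \sum_i tens (slot A (fun k => 1%:M) i).

Section Ring.
Variable K : comNzRingType.
Implicit Types A B C : forall i, 'M[K]_((d i).+1).

Lemma eq_tens A B : (forall i, A i = B i) -> tens A = tens B.
Proof.
by move=> AB; apply/matrixP => a b; rewrite !mxE; apply: eq_bigr => i _;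
  rewrite AB.
Qed.

Lemma tens_mul A B : tens A *m tens B = tens (fun i => A i *m B i).
Proof.
apply/matrixP => a b; rewrite !mxE.
under [RHS]eq_bigr do rewrite mxE.
rewrite prod_sum_dffun (reindex (@enum_val X predT)); last first.
  exact/onW_bij/enum_val_bij.
by apply: eq_bigr => j _; rewrite !mxE -big_split.
Qed.

Lemma tens1 : tens (fun i => 1%:M : 'M[K]_((d i).+1)) = 1%:M.
Proof.
apply/matrixP => a b; rewrite !mxE; have [<-|ab] := eqVneq a b.
  by apply: big1 => i _; rewrite mxE eqxx.
have [i iab] : exists i, (enum_val a : X) i != (enum_val b : X) i.
  apply/existsP; rewrite -negb_forall; apply: contra ab => /forallP eab.
  apply/eqP; apply: enum_val_inj; apply/ffunP => i; exact: (eqP (eab i)).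
by rewrite (bigD1 i) //= mxE (negPf iab) mul0r.
Qed.

Lemma tr_tens A : (tens A)^T = tens (fun i => (A i)^T).
Proof.
by apply/matrixP => a b; rewrite !mxE; apply: eq_bigr => i _; rewrite mxE.
Qed.

Lemma tens_scale (c : I -> K) A :
  tens (fun i => c i *: A i) = (\prod_i c i) *: tens A.
Proof.
apply/matrixP => a b; rewrite !mxE -big_split.
by apply: eq_bigr => i _; rewrite mxE.
Qed.

Lemma tens_slotB A A' B i :
  tens (slot A B i) - tens (slot A' B i) =
  tens (slot (fun k => A k - A' k) B i).
Proof.
apply/matrixP => a b; rewrite !mxE !(bigD1 i (P := xpredT)) //= /slot eqxx.
rewrite !mxE mulrBl; congr (_ * _ - _ * _);
  by apply: eq_bigr => k /negPf ki; rewrite ki.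
Qed.

Lemma slot_mul A A' B B' i k :
  slot A B i k *m slot A' B' i k =
  slot (fun k => A k *m A' k) (fun k => B k *m B' k) i k.
Proof. by rewrite /slot; case: eqP. Qed.

(** Operators in different slots commute, so in the double sum only the terms with both operators in
    the same slot survive. *)
Lemma tsum_commutator A B :
  tsum A *m tsum B - tsum B *m tsum A =
  tsum (fun i => A i *m B i - B i *m A i).
Proof.
rewrite /tsum !mulmx_suml.
under eq_bigr do rewrite mulmx_sumr.
under [X in _ - X]eq_bigr do rewrite mulmx_sumr.
rewrite [X in _ - X]exchange_big -sumrB; apply: eq_bigr => i _.
rewrite -sumrB (bigD1 i) //= big1 => [|j /negPf ji].
  rewrite addr0 !tens_mul -tens_slotB; congr (_ - _); apply: eq_tens => k;
    rewrite slot_mul /slot; case: eqP => // _; exact: mulmx1.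
rewrite !tens_mul; apply/eqP; rewrite subr_eq0; apply/eqP/eq_tens => k.
rewrite /slot; have [->|_] := eqVneq k i;
  first by rewrite eq_sym ji mulmx1 mul1mx.
by case: eqP; rewrite ?mulmx1 ?mul1mx.
Qed.

Lemma eq_tsum A B : (forall i, A i = B i) -> tsum A = tsum B.
Proof.
move=> AB; apply: eq_bigr => i _; apply: eq_tens => k.
by rewrite /slot AB.
Qed.

Lemma tsum_linear (x y : K) A B :
  tsum (fun i => x *: A i + y *: B i) = x *: tsum A + y *: tsum B.
Proof.
rewrite /tsum !scaler_sumr -big_split; apply: eq_bigr => i _ /=.
apply/matrixP => a b; rewrite !mxE !(bigD1 i (P := xpredT)) //= /slot eqxx !mxE.
rewrite mulrDl !mulrA; congr (_ * _ + _ * _);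
  by apply: eq_bigr => k /negPf ki; rewrite ki.
Qed.

Lemma tsumZ (x : K) A : tsum (fun i => x *: A i) = x *: tsum A.
Proof.
by rewrite -[RHS]addr0 -(scale0r (tsum A)) -tsum_linear; apply: eq_tsum => i;
  rewrite scale0r addr0.
Qed.

Lemma tr_tsum A : (tsum A)^T = tsum (fun i => (A i)^T).
Proof.
rewrite /tsum raddf_sum /=; apply: eq_bigr => i _; rewrite tr_tens.
by apply: eq_tens => k; rewrite /slot; case: eqP => // _; rewrite trmx1.
Qed.

Lemma tsum_diag (h : forall i, 'rV[K]_((d i).+1)) a b :
  tsum (fun i => diag_mx (h i)) a b =
  (\sum_i h i 0 ((enum_val a : X) i)) *+ (a == b).
Proof.
rewrite /tsum summxE -sumrMnl; apply: eq_bigr => i _; rewrite mxE.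
rewrite (bigD1 i) //= /slot eqxx mxE.
have [<-|ab] := eqVneq a b.
  rewrite eqxx big1 ?mulr1 // => k /negPf ki.
  by rewrite ki mxE eqxx.
(* The (a, b) entry of the identity [tens1] vanishes. If a and b agree in slot i, this says that the
   product over the other slots is 0. *)
have := congr1 (fun M : 'M_ _ => M a b) tens1.
rewrite !mxE (negPf ab) (bigD1 i) //= mxE.
case: eqP => [_|_ _]; last by rewrite !mulr0n mul0r.
rewrite mul1r !mulr1n mulr0n => e0.
have -> // : forall x, x = 0 -> h i 0 ((enum_val a : X) i) * x = 0.
  by move=> x ->; rewrite mulr0.
by rewrite -[RHS]e0; apply: eq_bigr => k /negPf ki; rewrite ki mxE.
Qed.

End Ring.

Lemma map_tens (K K' : comNzRingType) (f : {rmorphism K -> K'})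
    (A : forall i, 'M[K]_((d i).+1)) :
  map_mx f (tens A) = tens (fun i => map_mx f (A i)).
Proof.
apply/matrixP => a b; rewrite !mxE rmorph_prod.
by apply: eq_bigr => i _; rewrite mxE.
Qed.

Lemma map_tsum (K K' : comNzRingType) (f : {rmorphism K -> K'})
    (A : forall i, 'M[K]_((d i).+1)) :
  map_mx f (tsum A) = tsum (fun i => map_mx f (A i)).
Proof.
rewrite /tsum raddf_sum /=; apply: eq_bigr => i _; rewrite map_tens.
by apply: eq_tens => k; rewrite /slot; case: eqP => // _; rewrite map_mx1.
Qed.

Lemma deriv_prod_seq (K : comNzRingType) (r : seq I) (p : I -> {poly K}) :
  uniq r ->
  deriv (\prod_(i <- r) p i) =
  \sum_(i <- r) \prod_(k <- r) (if k == i then deriv (p k) else p k).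
Proof.
elim: r => [|j r IHr] /=; first by rewrite !big_nil derivC.
case/andP=> jr /IHr IH; rewrite !big_cons derivM eqxx IH big_distrr /=.
congr (_ * _ + _); apply: eq_big_seq => k kr.
  by rewrite ifN //; apply: contraNneq jr => <-.
by rewrite big_cons ifN //; apply: contraNneq jr => ->.
Qed.

Lemma deriv_prod (K : comNzRingType) (p : I -> {poly K}) :
  deriv (\prod_i p i) =
  \sum_i \prod_k (if k == i then deriv (p k) else p k).
Proof. exact/deriv_prod_seq/index_enum_uniq. Qed.

Lemma deriv_tens (K : comNzRingType) (P : forall i, 'M[{poly K}]_((d i).+1)) :
  map_mx deriv (tens P) =
  \sum_i tens (slot (fun k => map_mx deriv (P k)) P i).
Proof.
apply/matrixP => a b; rewrite !mxE summxE deriv_prod; apply: eq_bigr => i _.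
by rewrite mxE; apply: eq_bigr => k _; rewrite /slot; case: eqP; rewrite ?mxE.
Qed.

End Tensor.

(** * Representations of sl_2 *)

Section WeightSpace.
Variables (K : fieldType) (n : nat) (w : 'rV[K]_n) (a : K).

Lemma mxrank_eigenspace_diag :
  \rank (eigenspace (diag_mx w) a) = #|[pred j | w 0 j == a]|.
Proof.
set A := [pred j | w 0 j == a].
(* The rows of P are the unit vectors e_j with w_j = a. They are free as P P^T = 1, and they span
   the eigenspace as P^T P is the projector onto these coordinates. *)
pose P : 'M[K]_(#|A|, n) := \matrix_(i, j) (enum_val i == j)%:R.
have PPt : P *m P^T = 1%:M.
  apply/matrixP => i k; rewrite !mxE (bigD1 (enum_val i)) //= big1 =>
    [|j /negPf ji].
    by rewrite !mxE eqxx mul1r addr0 (inj_eq enum_val_inj) eq_sym.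
  by rewrite !mxE eq_sym ji mul0r.
have PtP j k : (P^T *m P) j k = ((j == k) && (j \in A))%:R.
  rewrite !mxE; have [jA|jA] := boolP (j \in A).
    rewrite (bigD1 (enum_rank_in jA j)) //= !mxE enum_rankK_in // eqxx mul1r.
    rewrite andbT big1 ?addr0 // => i ij; rewrite !mxE.
    case: eqP => [e|]; last by rewrite mul0r.
    by case/eqP: ij; apply: enum_val_inj; rewrite e enum_rankK_in.
  rewrite andbF big1 // => i _; rewrite !mxE; case: eqP => [e|]; last first.
    by rewrite mul0r.
  by rewrite -e enum_valP in jA.
have /eqmx_rank <- : (P == eigenspace (diag_mx w) a)%MS.
  apply/andP; split.
    apply/eigenspaceP/matrixP => i j; rewrite !mxE (bigD1 (enum_val i)) //=.
    rewrite big1 => [|k /negPf ki]; last by rewrite mxE eq_sym ki mul0r.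
    rewrite !mxE eqxx mul1r addr0.
    have /eqP -> : w 0 (enum_val i) == a by have := enum_valP i; rewrite inE.
    by rewrite mulr_natr.
  set V := eigenspace _ _; have /eigenspaceP VE := submx_refl V.
  move: V VE => V VE; suff -> : V = V *m P^T *m P by exact: submxMl.
  rewrite -mulmxA; apply/matrixP => i j; rewrite [RHS]mxE (bigD1 j) //= PtP.
  rewrite eqxx /= big1 => [|k /negPf kj]; last by rewrite PtP kj mulr0.
  rewrite addr0; have /matrixP/(_ i j) := VE; rewrite mul_mx_diag !mxE.
  rewrite inE; case: eqP => [_ _|/eqP wa]; first by rewrite mulr1.
  rewrite mulr0 => e; have /eqP : (w 0 j - a) * V i j = 0.
    by rewrite mulrBl -e mulrC subrr.
  by rewrite mulf_eq0 subr_eq0 (negPf wa) => /eqP.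
by apply/eqP; rewrite -/(row_free P); apply/row_freeP; exists P^T.
Qed.

End WeightSpace.

Lemma mulmx_adjoint_eq0 (C : numClosedFieldType) (m n : nat)
    (A : 'M[C]_(m, n)) :
  A *m (map_mx Num.conj A)^T = 0 -> A = 0.
Proof.
move=> AA; apply/matrixP => i j; rewrite mxE.
have /matrixP/(_ i i) := AA; rewrite !mxE.
under eq_bigr do rewrite !mxE -normCK.
move=> /psumr_eq0P h; have := h (fun k _ => exprn_ge0 _ (normr_ge0 _)) j isT.
by move/eqP; rewrite expf_eq0 /= normr_eq0 => /eqP.
Qed.

Section Sl2.
Variables (C : numClosedFieldType) (n : nat).
Variables (E F : 'M[C]_n) (w : 'rV[C]_n).
Local Notation H := (diag_mx w).
Hypothesis adjEF : F = (map_mx Num.conj E)^T.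
Hypothesis commEF : E *m F - F *m E = H.
Hypothesis commHE : H *m E - E *m H = 2%:R *: E.
Hypothesis commHF : H *m F - F *m H = - (2%:R *: F).

Local Notation Wt a := (eigenspace H a).
Local Notation count a := #|[pred j | w 0 j == a]|.

Lemma lower_eq0 m (v : 'M[C]_(m, n)) : v *m E *m F = 0 -> v *m E = 0.
Proof.
move=> vEF; apply: mulmx_adjoint_eq0; rewrite map_mxM trmx_mul -adjEF.
by rewrite mulmxA vEF mul0mx.
Qed.

(** Vectors are rows and operators act from the right. This reverses the usual roles: E lowers the
    weight, F raises it, and highest weight vectors are those killed by F. *)
Lemma weight_lower m (v : 'M[C]_(m, n)) a :
  v *m H = a *: v -> v *m E *m H = (a - 2) *: (v *m E).
Proof.
move=> vH; have -> : v *m E *m H = v *m (H *m E) - v *m (2%:R *: E).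
  by rewrite -mulmxBr -commHE opprB addrC subrK mulmxA.
by rewrite mulmxA vH -scalemxAl -scalemxAr -scalerBl.
Qed.

Lemma weight_raise m (v : 'M[C]_(m, n)) a :
  v *m H = a *: v -> v *m F *m H = (a + 2) *: (v *m F).
Proof.
move=> vH; have -> : v *m F *m H = v *m (H *m F) + v *m (2%:R *: F).
  by rewrite -mulmxDr -[2%:R *: F]opprK -commHF opprB addrC subrK mulmxA.
by rewrite mulmxA vH -scalemxAl -scalemxAr -scalerDl.
Qed.

(* On the weight space of a + 2, v E F = 0 forces v E = 0, and then
   |v F|^2 = v F E v^* = - (a + 2) |v|^2 forces v = 0; so v |-> v E F is
   injective there and F is onto. *)
Lemma mxrank_raise (a : nat) :
  \rank (Wt a%:R *m F) = count (a.+2%:R : C).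
Proof.
apply/eqP; rewrite eqn_leq -(mxrank_eigenspace_diag w) mxrankS /=; last first.
  by apply/eigenspaceP; rewrite -natr1 -natr1 -addrA; apply: weight_raise;
    apply/eigenspaceP; exact: submx_refl.
set V := Wt a.+2%:R.
have /eigenspaceP VH := submx_refl V; rewrite -/V in VH.
suff rV : \rank (V *m E *m F) = \rank V.
  rewrite -rV; apply: mxrankS; apply: submxMr; apply/eigenspaceP.
  have -> : a%:R = a.+2%:R - 2 :> C by rewrite -addn2 natrD addrK.
  exact: weight_lower.
rewrite -mulmxA; apply/mxrank_injP/rowV0P => v; rewrite sub_capmx => /andP[vV].
move=> /sub_kermxP; rewrite mulmxA => /lower_eq0 vE.
have /eigenspaceP vH := vV.
have : v *m F *m E = - (a.+2%:R *: v).
  by rewrite -vH -commEF mulmxBr mulmxA vE mul0mx sub0r opprK mulmxA.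
move=> vFE; pose u := v *m F.
have : u *m (map_mx Num.conj u)^T = - (a.+2%:R *: (v *m (map_mx Num.conj v)^T)).
  have FE : (map_mx Num.conj F)^T = E.
    by rewrite adjEF; apply/matrixP => i j; rewrite !mxE conjCK.
  by rewrite /u map_mxM trmx_mul FE mulmxA vFE mulNmx scalemxAl.
move/matrixP/(_ 0 0); rewrite !mxE.
have sq m (x : 'rV[C]_m) : \sum_j x 0 j * (map_mx Num.conj x)^T j 0 =
    \sum_j `|x 0 j| ^+ 2.
  by apply: eq_bigr => j _; rewrite !mxE normCK.
rewrite !sq => uv.
have sge0 m (x : 'rV[C]_m) : 0 <= \sum_j `|x 0 j| ^+ 2.
  by apply: sumr_ge0 => j _; exact: exprn_ge0.
have : \sum_j `|v 0 j| ^+ 2 = 0.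
  apply/eqP; rewrite eq_le sge0 andbT -(pmulr_rle0 _ (ltr0Sn C a.+1)).
  by rewrite -oppr_ge0 -uv sge0.
move/psumr_eq0P => h; apply/rowP => j; rewrite mxE.
have := h (fun k _ => exprn_ge0 _ (normr_ge0 _)) j isT.
by move/eqP; rewrite expf_eq0 /= normr_eq0 => /eqP.
Qed.

Definition highest (a : nat) := (Wt a%:R :&: kermx F)%MS.

(** Rank-nullity for F, which maps the weight space of a onto that of a + 2. *)
Lemma mxrank_highest (a : nat) :
  (\rank (highest a) + count (a.+2%:R : C))%N = count (a%:R : C).
Proof.
by rewrite -mxrank_raise -(mxrank_eigenspace_diag w) addnC mxrank_mul_ker.
Qed.

End Sl2.

(** * Spin matrices and their intertwiners *)

Section Spin.
Variable R : rcfType.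

(** With k = ell + m this is sqrt ((ell + m + 1) (ell - m)), the coefficient of the ladder operators
    in an orthonormal weight basis. *)
Definition spin_coef (d k : nat) : R[i] := (Num.sqrt ((k.+1 * (d - k))%:R :
  R))%:C.

Lemma spin_coef_sq d k : spin_coef d k * spin_coef d k = (k.+1 * (d - k))%:R.
Proof.
by rewrite -rmorphM /= -expr2 sqr_sqrtr ?ler0n // rmorph_nat.
Qed.

Lemma spin_coef_neq0 d k : (k < d)%N -> spin_coef d k != 0.
Proof.
move=> kd; have : spin_coef d k * spin_coef d k != 0.
  by rewrite spin_coef_sq pnatr_eq0 muln_eq0 /= subn_eq0 -ltnNge.
by rewrite mulf_eq0 orbb.
Qed.

Lemma spin_coef_out d : spin_coef d d = 0.
Proof. by rewrite /spin_coef subnn muln0 sqrtr0. Qed.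

Lemma spin_coef_rev d k : (k < d)%N -> spin_coef d (d - k.+1) = spin_coef d k.
Proof.
move=> kd; rewrite /spin_coef; have -> : ((d - k.+1).+1 = d - k)%N by lia.
have -> : (d - (d - k.+1) = k.+1)%N by lia.
by rewrite mulnC.
Qed.

Definition spinE (d : nat) : 'M[R[i]]_(d.+1) :=
  \matrix_(j, k) if j == k.+1 :> nat then spin_coef d k else 0.

Definition spinF (d : nat) : 'M[R[i]]_(d.+1) := (spinE d)^T.

Definition spin_weight (d : nat) : 'rV[R[i]]_(d.+1) :=
  \row_k ((k.*2)%:R - d%:R).

Lemma spin_adjoint d : spinF d = (map_mx Num.conj (spinE d))^T.
Proof.
apply/matrixP => j k; rewrite !mxE; case: ifP => _; last by rewrite rmorph0.
exact/esym/conjc_real.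
Qed.

Lemma spinE_mul d n (A : 'M[R[i]]_(d.+1, n)) (k : 'I_d.+1) :
  row k (spinE d *m A) =
  if (k : nat) is k'.+1 then spin_coef d k' *: row (inord k') A else 0.
Proof.
rewrite row_mul; case: k => -[|k] kd /=.
  by apply/rowP => j; rewrite !mxE big1 // => i _; rewrite !mxE mul0r.
apply/rowP => j; rewrite !mxE (bigD1 (inord k)) //= !mxE inordK ?eqxx ?(ltnW
  kd) //.
rewrite big1 ?addr0 // => i ik; rewrite !mxE eqSS ifN ?mul0r //=.
by apply: contraNneq ik => ->; rewrite inord_val.
Qed.

(** For k = d the index [inord k.+1] is a default value, made harmless by [spin_coef d d] = 0. *)
Lemma spinF_mul d n (A : 'M[R[i]]_(d.+1, n)) (k : 'I_d.+1) :
  row k (spinF d *m A) = spin_coef d k *: row (inord k.+1) A.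
Proof.
rewrite row_mul; apply/rowP => j; rewrite !mxE; have [kd|kd] := ltnP k d.
  rewrite (bigD1 (inord k.+1)) //= !mxE inordK ?eqxx //.
  rewrite big1 ?addr0 // => i ik; rewrite !mxE ifN ?mul0r //=.
  by apply: contraNneq ik => <-; rewrite inord_val.
have -> : spin_coef d k = 0.
  by rewrite -(spin_coef_out d); congr spin_coef; apply/eqP;
    rewrite eqn_leq kd -ltnS ltn_ord.
rewrite mul0r big1 // => i _; rewrite !mxE ifN ?mul0r //.
by have := ltn_ord i; lia.
Qed.

Lemma spin_commEF d :
  spinE d *m spinF d - spinF d *m spinE d = diag_mx (spin_weight d).
Proof.
apply/row_matrixP => k; rewrite linearB /= spinE_mul spinF_mul.
have rF i : (i < d.+1)%N -> row (inord i) (spinF d) =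
    spin_coef d i *: 'e_(inord i.+1).
  move=> id; have := spinF_mul (1%:M : 'M_(d.+1)) (inord i).
  by rewrite mulmx1 inordK // row1.
have rE i : (i < d.+1)%N -> row (inord i) (spinE d) =
    if i is k'.+1 then spin_coef d k' *: 'e_(inord k') else 0.
  move=> id; have := spinE_mul (1%:M : 'M_(d.+1)) (inord i).
  by rewrite mulmx1 inordK // => ->; case: (i) => // i'; rewrite row1.
have -> : row k (diag_mx (spin_weight d)) = ((k.*2)%:R - d%:R) *: 'e_k.
  apply/rowP => j; rewrite !mxE eqxx /= eq_sym.
  by case: eqP => _; rewrite ?mulr1 ?mulr0.
have -> : spin_coef d k *: row (inord k.+1) (spinE d) =
    (k.+1 * (d - k))%:R *: 'e_k.
  have [kd|kd] := ltnP k d; last first.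
    have -> : k = d :> nat by apply/eqP; rewrite eqn_leq kd -ltnS ltn_ord.
    by rewrite spin_coef_out subnn muln0 !scale0r.
  by rewrite rE // scalerA spin_coef_sq inord_val.
have -> : (if k : nat is k'.+1 then spin_coef d k' *: row (inord k') (spinF d)
    else 0) = (k * (d - k.-1))%:R *: 'e_k.
  case: k => -[|k] kd /=; first by rewrite mul0n scale0r.
  rewrite rF ?(ltnW kd) // scalerA spin_coef_sq; congr (_ *: 'e_ _).
  by apply: val_inj; rewrite /= inordK.
rewrite -scalerBl; congr (_ *: _).
case: k => -[|k'] kd /=; first by rewrite subn0 mul1n.
have k'd : (k' < d)%N by [].
by rewrite !natrM !natrB ?(ltnW k'd) // -muln2 natrM -!natr1; ring.
Qed.

Lemma spin_commHE d :
  diag_mx (spin_weight d) *m spinE d - spinE d *m diag_mx (spin_weight d) =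
  2%:R *: spinE d.
Proof.
apply/matrixP => j k; rewrite mul_diag_mx mul_mx_diag !mxE.
case: ifP => [/eqP ->|_]; last by ring.
by rewrite doubleS -!natr1; ring.
Qed.

Lemma spin_commHF d :
  diag_mx (spin_weight d) *m spinF d - spinF d *m diag_mx (spin_weight d) =
  - (2%:R *: spinF d).
Proof.
apply/matrixP => j k; rewrite mul_diag_mx mul_mx_diag !mxE.
case: ifP => [/eqP ->|_]; last by ring.
by rewrite doubleS -!natr1; ring.
Qed.

Section Intertwiners.
Variable n : nat.
Variables (E F : 'M[R[i]]_n) (w : 'rV[R[i]]_n).
Local Notation H := (diag_mx w).
Hypothesis adjEF : F = (map_mx Num.conj E)^T.
Hypothesis commEF : E *m F - F *m E = H.
Hypothesis commHE : H *m E - E *m H = 2%:R *: E.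
Hypothesis commHF : H *m F - F *m H = - (2%:R *: F).
Variable D : nat.

Definition intertwiner (c : 'M[R[i]]_(D.+1, n)) : Prop :=
  spinE D *m c = c *m E /\ spinF D *m c = c *m F.

(** The normalization is the one for which E links consecutive vectors with the coefficients of
    [spinE D]; only j <= D matters, where no divisor vanishes. *)
Fixpoint ladder (v : 'rV[R[i]]_n) (j : nat) : 'rV[R[i]]_n :=
  if j is j'.+1 then (spin_coef D j')^-1 *: (ladder v j' *m E) else v.

Definition ladder_mx (v : 'rV[R[i]]_n) : 'M[R[i]]_(D.+1, n) :=
  \matrix_(k < D.+1) ladder v (D - k).

Lemma ladder_linear a u v j :
  ladder (a *: u + v) j = a *: ladder u j + ladder v j.
Proof.
elim: j => [|j IHj] //=; rewrite IHj mulmxDl scalerDr -scalemxAl.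
by rewrite !scalerA [a * _]mulrC.
Qed.

Lemma ladder_mx_sum m (a : 'I_m -> R[i]) (u : 'I_m -> 'rV[R[i]]_n) :
  ladder_mx (\sum_i a i *: u i) = \sum_i a i *: ladder_mx (u i).
Proof.
have lad0 j : ladder 0 j = 0.
  by have := ladder_linear (-1) 0 0 j; rewrite scaler0 addr0 scaleN1r addNr.
rewrite (big_morph ladder_mx (op1 := +%R) (id1 := 0)); last 2 first.
- move=> x y; apply/row_matrixP => k; rewrite linearD /= !rowK.
  by have := ladder_linear 1 x y (D - k); rewrite !scale1r.
- by apply/row_matrixP => k; rewrite rowK lad0 row0.
apply: eq_bigr => i _; apply/row_matrixP => k; rewrite linearZ /= !rowK.
by have := ladder_linear (a i) (u i) 0 (D - k); rewrite lad0 !addr0.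
Qed.

Section Highest.
Variable v : 'rV[R[i]]_n.
Hypotheses (vH : v *m H = D%:R *: v) (vF : v *m F = 0).

(** Induction with E F = F E + H: the scalar grows by the weight D - 2 j, from j (D - j + 1) to (j +
    1) (D - j). *)
Lemma ladder_weight_EF j : (j <= D)%N ->
  ladder v j *m H = (D%:R - (j.*2)%:R) *: ladder v j /\
  ladder v j *m E *m F = (j.+1 * (D - j))%:R *: ladder v j.
Proof.
have EF u : u *m E *m F = u *m F *m E + u *m H.
  by rewrite -commEF mulmxBr !mulmxA addrC subrK.
elim: j => [|j IHj] jD.
  by rewrite /= subr0 subn0 mul1n EF vF mul0mx add0r vH.
have [jH jEF] := IHj (ltnW jD); set u := ladder v j in jH jEF *.
have uH : ladder v j.+1 *m H = (D%:R - (j.+1.*2)%:R) *: ladder v j.+1.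
  rewrite /= -/u -scalemxAl (weight_lower commHE jH) !scalerA mulrC.
  by congr (_ * _ *: _); rewrite doubleS -!natr1; ring.
split=> //; rewrite EF uH /= -/u -!scalemxAl jEF -!scalemxAl !scalerA -scalerDl.
congr (_ *: _); rewrite [_^-1 * _]mulrC -mulrDl; congr (_ * _).
rewrite !natrM !natrB ?(ltnW jD) // -muln2 !natrM -!natr1.
by ring.
Qed.

Lemma ladder_mx_intertwiner : intertwiner (ladder_mx v).
Proof.
have lE j : (j < D)%N -> spin_coef D j *: ladder v j.+1 = ladder v j *m E.
  by move=> jD; rewrite /= scalerA mulfV ?scale1r // spin_coef_neq0.
split; apply/row_matrixP => k; rewrite [RHS]row_mul rowK.
  rewrite spinE_mul; case: k => -[|k] kD /=.
    (* The chain must stop after D steps: at j = D the scalar of E F is 0, and by positivity E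
       itself then kills the vector. *)
    rewrite subn0; apply/esym/(lower_eq0 adjEF).
    by have [_ ->] := ladder_weight_EF (leqnn D); rewrite subnn muln0 scale0r.
  rewrite rowK inordK ?(ltnW kD) // -lE; last by lia.
  by rewrite -[(D - k.+1).+1]subSn // subSS spin_coef_rev.
rewrite spinF_mul; have [kD|kD] := ltnP k D; last first.
  have -> : k = D :> nat by apply/eqP; rewrite eqn_leq kD -ltnS ltn_ord.
  by rewrite spin_coef_out scale0r subnn /= vF.
rewrite rowK inordK //; have -> : (D - k = (D - k.+1).+1)%N by lia.
set j := (D - k.+1)%N; have jD : (j < D)%N by rewrite /j; lia.
rewrite /= -scalemxAl (ladder_weight_EF (ltnW jD)).2 scalerA -spin_coef_sq.
by rewrite mulrA mulVf ?spin_coef_neq0 // mul1r /j spin_coef_rev.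
Qed.

End Highest.

(** [spinF D] annihilates the top row because [spin_coef D D] = 0, so F kills the top row of c; the
    relation for E then computes each row from the one above it. *)
Lemma intertwinerE c : intertwiner c ->
  (row ord_max c <= highest F w D)%MS /\ c = ladder_mx (row ord_max c).
Proof.
case=> cE cF.
have top : row ord_max c *m F = 0.
  by rewrite -row_mul -cF spinF_mul /= spin_coef_out scale0r.
have cH : diag_mx (spin_weight D) *m c = c *m H.
  rewrite -spin_commEF -commEF mulmxBl mulmxBr -!mulmxA cE cF.
  by rewrite !mulmxA cE cF.
split.
  rewrite sub_capmx; apply/andP; split; last exact/sub_kermxP.
  apply/eigenspaceP; rewrite -row_mul -cH; apply/rowP => j.
  by rewrite mul_diag_mx !mxE /=; congr (_ * _); rewrite -addnn natrD addrK.
have lad j : (j <= D)%N -> row (inord (D - j)) c = ladder (row ord_max c) j.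
  elim: j => [|j IHj] jD /=.
    by rewrite subn0; congr row; apply: val_inj; rewrite /= inordK.
  rewrite -IHj 1?ltnW // -row_mul -cE spinE_mul inordK ?ltnS ?leq_subr //.
  have -> : (D - j = (D - j.+1).+1)%N by lia.
  by rewrite spin_coef_rev // scalerA mulVf ?scale1r // spin_coef_neq0.
apply/row_matrixP => k; rewrite rowK -lad ?leq_subr // subKn ?inord_val //.
by rewrite -ltnS ltn_ord.
Qed.

(** Taking the top row is a linear bijection onto the highest weight vectors of weight D, with
    inverse [ladder_mx]. The count is additive to avoid truncated subtraction. *)
Lemma dim_intertwiner :
  exists (m : nat),
    (m + #|[pred j | w 0%R j == D.+2%:R]| = #|[pred j | w 0%R j == D%:R]|)%N /\
    has_dimension intertwiner m.
Proof.
exists (\rank (highest F w D)); split; first exact: (mxrank_highest adjEF).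
pose B := row_base (highest F w D).
have Brow i : row i B *m H = D%:R *: row i B /\ row i B *m F = 0.
  have : (row i B <= highest F w D)%MS by rewrite (submx_trans (row_sub i
    B)) // eq_row_base.
  by rewrite sub_capmx => /andP[/eigenspaceP ? /sub_kermxP].
exists (fun i => ladder_mx (row i B)); split=> [a|c].
  rewrite -ladder_mx_sum => /(congr1 (row ord_max)).
  rewrite rowK row0 /= subnn /= => aB i.
  have : (\row_i a i) *m B = 0.
    by rewrite mulmx_sum_row -[RHS]aB; apply: eq_bigr => k _; rewrite mxE.
  have := row_base_free (highest F w D); rewrite -/B -kermx_eq0 => /eqP B0.
  move/sub_kermxP; rewrite B0 submx0 => /eqP/rowP/(_ i).
  by rewrite !mxE.
split=> [/intertwinerE[cV cE]|[a ->]].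
  have /submxP[x xB] : (row ord_max c <= B)%MS by rewrite eq_row_base.
  exists (fun i => x 0 i).
  by rewrite cE xB mulmx_sum_row ladder_mx_sum.
rewrite -ladder_mx_sum; apply: ladder_mx_intertwiner.
  rewrite mulmx_suml scaler_sumr; apply: eq_bigr => i _.
  by rewrite -scalemxAl (Brow i).1 !scalerA mulrC.
by rewrite mulmx_suml big1 // => i _; rewrite -scalemxAl (Brow i).2 scaler0.
Qed.

End Intertwiners.
End Spin.

(** * Binary forms and Wigner matrices *)

Section BinaryForms.
Variable K : comNzRingType.
Implicit Types U V : 'M[K]_2.

Definition mx2 (a b c e : K) : 'M[K]_2 :=
  \matrix_(p, q) if p == 0 then (if q == 0 then a else b)
                 else (if q == 0 then c else e).

Lemma mx2E U : U = mx2 (U 0 0) (U 0 1) (U 1 0) (U 1 1).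
Proof.
by apply/matrixP => p q; rewrite mxE; case: p q => -[|[|//]] ip [[|[|//]] iq];
  congr (U _ _); apply: val_inj.
Qed.

Lemma mx2_mul a b c e a' b' c' e' :
  mx2 a b c e *m mx2 a' b' c' e' =
  mx2 (a * a' + b * c') (a * b' + b * e') (c * a' + e * c') (c * b' + e * e').
Proof.
rewrite [LHS]mx2E; congr mx2; by rewrite !mxE !big_ord_recl big_ord0 addr0 !mxE.
Qed.

Lemma det_mx2 a b c e : \det (mx2 a b c e) = a * e - b * c.
Proof.
rewrite (expand_det_row _ 0) !big_ord_recl big_ord0 /cofactor !det_mx11 !mxE /=.
by rewrite expr0 expr1; ring.
Qed.

Lemma mx2_1 : mx2 1 0 0 1 = 1%:M.
Proof. by rewrite [RHS]mx2E !mxE. Qed.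

Definition lin_form U (q : 'I_2) : {poly K} := U 0 q *: 'X + (U 1 q)%:P.

(** The substitution f |-> f ((x, y) U) in the monomial basis x^k y^(d - k), at y = 1; the Wigner
    matrix is its conjugate by a diagonal matrix. *)
Definition bform (d : nat) U : 'M[K]_(d.+1) :=
  \matrix_(j, k) (lin_form U 0 ^+ k * lin_form U 1 ^+ (d - k))`_j.

(** The degree d is an argument because setting y = 1 forgets the power of y. *)
Definition form_subst U (d : nat) (p : {poly K}) : {poly K} :=
  \sum_(i < d.+1) p`_i *: (lin_form U 0 ^+ i * lin_form U 1 ^+ (d - i)).

Lemma size_lin_form U q : (size (lin_form U q) <= 2)%N.
Proof.
rewrite (leq_trans (size_polyD _ _)) // geq_max (leq_trans (size_scale_leq _
  _)).
  by rewrite (leq_trans (size_polyC_leq1 _)).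
by rewrite size_polyX.
Qed.

Lemma form_subst_mul U d (p : {poly K}) a b : (size p <= d.+1)%N ->
  form_subst U d.+1 (p * (a *: 'X + b%:P)) =
  form_subst U d p * (a *: lin_form U 0 + b *: lin_form U 1).
Proof.
move=> pd; rewrite /form_subst [RHS]mulrDr !big_distrl /=.
set A := lin_form U 0; set B := lin_form U 1.
transitivity (\sum_(i < d.+2) (a * (p * 'X)`_i) *: (A ^+ i * B ^+ (d.+1 - i)) +
  \sum_(i < d.+2) (b * p`_i) *: (A ^+ i * B ^+ (d.+1 - i))).
  rewrite -big_split; apply: eq_bigr => i _ /=; rewrite -scalerDl mulrDr.
  by rewrite coefD -scalerAr coefZ coefMC [p`_i * b]mulrC.
congr (_ + _).
  rewrite big_ord_recl coefMX eqxx mulr0 scale0r add0r; apply: eq_bigr => i _.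
  rewrite coefMX /= subSS -scalerAl -scalerAr scalerA [a * _]mulrC exprS.
  by congr (_ *: _); ring.
rewrite big_ord_recr /= [p`_d.+1]nth_default // mulr0 scale0r addr0.
apply: eq_bigr => i _; rewrite subSn -1?ltnS // exprS.
by rewrite -scalerAl -scalerAr scalerA [b * _]mulrC; congr (_ *: _); ring.
Qed.

Lemma size_lin_form_exp U q m : (size (lin_form U q ^+ m) <= m.+1)%N.
Proof.
elim: m => [|m IHm]; first by rewrite expr0 size_poly1.
rewrite exprS (leq_trans (size_polyMleq _ _)) //.
have := size_lin_form U q; lia.
Qed.

Lemma size_lin_forms U k m :
  (size (lin_form U 0 ^+ k * lin_form U 1 ^+ m)%R <= (k + m).+1)%N.
Proof.
rewrite (leq_trans (size_polyMleq _ _)) //.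
have := size_lin_form_exp U 0 k; have := size_lin_form_exp U 1 m; lia.
Qed.

Lemma lin_form_mul U V q :
  V 0 q *: lin_form U 0 + V 1 q *: lin_form U 1 = lin_form (U *m V) q.
Proof.
rewrite /lin_form !mxE !big_ord_recl !big_ord0 !addr0.
have -> : lift ord0 ord0 = 1 :> 'I_2 by apply: val_inj.
rewrite -!mul_polyC !rmorphD !rmorphM /=; ring.
Qed.

Lemma form_subst_lin_forms U V k m :
  form_subst U (k + m) (lin_form V 0 ^+ k * lin_form V 1 ^+ m) =
  lin_form (U *m V) 0 ^+ k * lin_form (U *m V) 1 ^+ m.
Proof.
elim: m => [|m IHm]; last first.
  rewrite addnS !exprSr !mulrA [lin_form V 1 in LHS]/lin_form.
  by rewrite form_subst_mul ?size_lin_forms // IHm lin_form_mul.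
rewrite addn0 !expr0 !mulr1; elim: k => [|k IHk].
  by rewrite !expr0 /form_subst big_ord1 coef1 scale1r mulr1.
rewrite !exprSr [lin_form V 0 in LHS]/lin_form form_subst_mul
  ?size_lin_form_exp //.
by rewrite IHk lin_form_mul.
Qed.

Lemma bform_mul d U V : bform d (U *m V) = bform d U *m bform d V.
Proof.
apply/matrixP => j k; rewrite !mxE.
have kd : (k <= d)%N by rewrite -ltnS.
rewrite -form_subst_lin_forms subnKC // /form_subst coef_sum.
by apply: eq_bigr => i _; rewrite coefZ !mxE mulrC.
Qed.

Lemma bform1 d : bform d 1%:M = 1%:M.
Proof.
apply/matrixP => j k; rewrite !mxE /lin_form !mxE /= scale1r addr0 scale0r
  add0r.
by rewrite expr1n mulr1 coefXn.
Qed.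

Lemma bform_scale d a U : bform d (a *: U) = a ^+ d *: bform d U.
Proof.
apply/matrixP => j k; rewrite !mxE.
have linZ q : lin_form (a *: U) q = a *: lin_form U q.
  by rewrite /lin_form !mxE scalerDr scalerA polyCM mul_polyC.
rewrite !linZ !exprZn -scalerAl -scalerAr scalerA -exprD subnKC -1?ltnS //.
by rewrite coefZ.
Qed.

Lemma coef_lin_expr_l (a : K) m i : ((a *: 'X + 1%:P) ^+ m)`_i =
  a ^+ i *+ 'C(m, i).
Proof.
rewrite addrC exprDn coef_sum.
have coefE j : (1%:P ^+ (m - j) * (a *: 'X) ^+ j *+ 'C(m, j))`_i =
    (a ^+ j * (i == j)%:R) *+ 'C(m, j).
  by rewrite coefMn exprZn -polyC_exp expr1n mul1r coefZ coefXn.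
have [im|im] := ltnP i m.+1.
  rewrite (bigD1 (Ordinal im)) //= big1 => [|j ji]; last first.
    by rewrite coefE; case: eqP => [e|_]; rewrite ?mulr0 ?mul0rn //;
      case/eqP: ji; exact: val_inj.
  by rewrite addr0 coefE eqxx mulr1.
rewrite bin_small // mulr0n big1 // => j _;
  rewrite coefE gtn_eqF ?mulr0 ?mul0rn //.
by rewrite (leq_trans (ltn_ord j)).
Qed.

Lemma coef_lin_expr_r (a : K) m i :
  (('X + a%:P) ^+ m)`_i = a ^+ (m - i) *+ 'C(m, i).
Proof.
rewrite addrC exprDn coef_sum.
have coefE j : (a%:P ^+ (m - j) * 'X ^+ j *+ 'C(m, j))`_i =
    (a ^+ (m - j) * (i == j)%:R) *+ 'C(m, j).
  by rewrite coefMn -polyC_exp coefCM coefXn.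
have [im|im] := ltnP i m.+1.
  rewrite (bigD1 (Ordinal im)) //= big1 => [|j ji]; last first.
    by rewrite coefE; case: eqP => [e|_]; rewrite ?mulr0 ?mul0rn //;
      case/eqP: ji; exact: val_inj.
  by rewrite addr0 coefE eqxx mulr1.
rewrite bin_small // mulr0n big1 // => j _;
  rewrite coefE gtn_eqF ?mulr0 ?mul0rn //.
by rewrite (leq_trans (ltn_ord j)).
Qed.

End BinaryForms.

Section ConstMatrix.
Variable K : comNzRingType.

Lemma deriv_mulmx_constl m n p (A : 'M[K]_(m, n)) (B : 'M[{poly K}]_(n, p)) :
  map_mx deriv (map_mx polyC A *m B) = map_mx polyC A *m map_mx deriv B.
Proof.
apply/matrixP => i j; rewrite !mxE raddf_sum /=; apply: eq_bigr => k _.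
by rewrite !mxE derivM derivC mul0r add0r.
Qed.

Lemma deriv_mulmx_constr m n p (A : 'M[{poly K}]_(m, n)) (B : 'M[K]_(n, p)) :
  map_mx deriv (A *m map_mx polyC B) = map_mx deriv A *m map_mx polyC B.
Proof.
apply/matrixP => i j; rewrite !mxE raddf_sum /=; apply: eq_bigr => k _.
by rewrite !mxE derivM derivC mulr0 addr0.
Qed.

Lemma horner_const_mx m n (A : 'M[K]_(m, n)) x :
  map_mx (horner_eval x) (map_mx polyC A) = A.
Proof. by apply/matrixP => i j; rewrite !mxE /horner_eval hornerC. Qed.

(** The operators x d/dy (here) and y d/dx ([bformF]) on forms of degree d, which generate the two
    unipotent subgroups. *)
Definition bformE d : 'M[K]_(d.+1) :=
  \matrix_(j, k) if j == k.+1 :> nat then (d - k)%:R else 0.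

Definition bformF d : 'M[K]_(d.+1) :=
  \matrix_(j, k) if k == j.+1 :> nat then k%:R else 0.

Definition unip_upper (x : K) : 'M[K]_2 := mx2 1 x 0 1.
Definition unip_lower (x : K) : 'M[K]_2 := mx2 1 0 x 1.

Lemma bform_upperE d x (j k : 'I_d.+1) :
  bform d (unip_upper x) j k =
  if (j < k)%N then 0 else x ^+ (j - k) *+ 'C(d - k, j - k).
Proof.
rewrite !mxE /lin_form !mxE /= scale1r addr0 coefXnM.
by case: ifP => // _; rewrite coef_lin_expr_l.
Qed.

Lemma bform_lowerE d x (j k : 'I_d.+1) :
  bform d (unip_lower x) j k = x ^+ (k - j) *+ 'C(k, j).
Proof.
rewrite !mxE /lin_form !mxE /= scale1r scale0r add0r expr1n mulr1.
exact: coef_lin_expr_r.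
Qed.

End ConstMatrix.

Section PolyUnipotent.
Variable K : comNzRingType.

(** Upper unipotent matrices form a one-parameter group, hence P' = P E; on entries this is n C(n -
    1, i) = (i + 1) C(n, i + 1) with n = d - k. *)
Lemma deriv_bform_upper d :
  map_mx deriv (bform d (unip_upper ('X : {poly K}))) =
  bform d (unip_upper 'X) *m map_mx polyC (bformE K d).
Proof.
apply/matrixP => j k; rewrite [LHS]mxE bform_upperE [RHS]mxE.
have [kd|kd] := ltnP k d; last first.
  have kE : k = d :> nat by apply/eqP; rewrite eqn_leq kd -ltnS ltn_ord.
  rewrite big1 => [|i _]; last first.
    rewrite !mxE ifN ?polyC0 ?mulr0 //; have := ltn_ord i; lia.
  case: ltnP => kj; first by rewrite derivC.
  have -> : (j - k = 0)%N by have := ltn_ord j; lia.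
  by rewrite expr0 bin0 derivC.
rewrite (bigD1 (inord k.+1)) //= big1 => [|i ik]; last first.
  rewrite !mxE ifN ?polyC0 ?mulr0 //.
  by apply: contraNneq ik => e; apply/eqP/val_inj; rewrite /= inordK.
rewrite addr0 bform_upperE inordK // !mxE inordK // eqxx.
have [jk|kj] := ltnP j k.
  by rewrite ltnW // mul0r derivC.
rewrite ltnS leq_eqVlt; have [->|jk] /= := eqVneq (j : nat) k.
  by rewrite subnn expr0 bin0 derivC mul0r.
have kj' : (k < j)%N by rewrite ltn_neqAle eq_sym jk.
rewrite ltnNge (ltnW kj') /= derivMn derivXn.
have [i ji] : exists i, (j - k = i.+1)%N by exists (j - k).-1; lia.
have [e de] : exists e, (d - k = e.+1)%N by exists (d - k).-1; lia.
have -> : (j - k.+1 = i)%N by lia.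
have -> : (d - k.+1 = e)%N by lia.
rewrite ji de /= polyC_natr mulr_natr -!mulrnA.
by rewrite -mul_bin_diag mulnC.
Qed.

Lemma deriv_bform_lower d :
  map_mx deriv (bform d (unip_lower ('X : {poly K}))) =
  bform d (unip_lower 'X) *m map_mx polyC (bformF K d).
Proof.
apply/matrixP => j k; rewrite [LHS]mxE bform_lowerE [RHS]mxE.
case: k => -[|k] kd /=.
  rewrite big1 => [|i _]; last by rewrite !mxE /= polyC0 mulr0.
  by rewrite sub0n expr0 derivMn derivC mul0rn.
rewrite (bigD1 (inord k)) //= big1 => [|i ik]; last first.
  rewrite !mxE /= eqSS ifN ?polyC0 ?mulr0 //.
  by apply: contraNneq ik => ->; rewrite inord_val.
rewrite addr0 bform_lowerE inordK ?(ltnW kd) // !mxE inordK ?(ltnW kd) // eqxx.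
have [jk|kj] := leqP j k.
  rewrite subSn // derivMn derivXn /= polyC_natr mulr_natr -!mulrnA.
  by rewrite -subSn // -mul_bin_down mulnC.
rewrite (bin_small kj) mulr0n mul0r; move: kj;
  rewrite leq_eqVlt => /orP[/eqP <-|kj].
  by rewrite subnn expr0 derivMn derivC mul0rn.
by rewrite bin_small // mulr0n derivC.
Qed.

Lemma deriv0_exprM (a b : K) p q :
  (deriv ((a *: 'X) ^+ p * (b *: 'X) ^+ q : {poly K})).[0] =
  a ^+ p * b ^+ q *+ (p + q == 1)%N.
Proof.
rewrite !exprZn -scalerAl -scalerAr scalerA -exprD derivZ derivXn hornerZ.
rewrite hornerMn hornerXn; case: (p + q)%N => [|[|r]] /=.
- by rewrite !mulr0n mulr0.
- by rewrite expr0 mulr1.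
- by rewrite expr0n mul0rn mulr0.
Qed.

Lemma deriv0_bform d (x y : K) :
  map_mx (horner_eval 0) (map_mx deriv (bform d (mx2 1 (x *: 'X) (y *: 'X) 1)))
    =
  x *: bformE K d + y *: bformF K d.
Proof.
apply/matrixP => j k; rewrite !mxE /lin_form !mxE /= scale1r coefM raddf_sum /=.
rewrite /horner_eval horner_sum.
under eq_bigr => i _.
  rewrite coef_lin_expr_l coef_lin_expr_r mulrnAl mulrnAr -mulrnA derivMn
    hornerMn.
  rewrite deriv0_exprM -mulrnA.
  over.
(* The i-th term has degree (k - i) + (j - i) in the curve parameter. Its derivative at 0 survives
   only for degree 1, which forces i = min (j, k) and |j - k| = 1. *)
have out (i : 'I_j.+1) : (i : nat) != minn j k ->
    y ^+ (k - i) * x ^+ (j - i) *+ ((k - i + (j - i) == 1)%N * ('C(d - k, j -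
      i) * 'C(k, i))) = 0.
  move=> ij; have [ki|ik] := ltnP k i; first by rewrite (bin_small ki) !muln0.
  have -> : (k - i + (j - i) == 1)%N = false; last by rewrite mul0n.
  by have := ltn_ord i; rewrite ltnS; move: ij; rewrite /minn; case: ifP; lia.
have mj : (minn j k < j.+1)%N by rewrite ltnS geq_minl.
rewrite (bigD1 (Ordinal mj)) //= big1 ?addr0; last first.
  by move=> i ij; apply: out; apply: contraNneq ij => e; apply/eqP/val_inj.
rewrite /= /minn; case: ltnP => [jk|kj].
  rewrite subnn addn0 bin0 mul1n (ltn_eqF (ltnW jk : (j < k.+1)%N)) mulr0 add0r.
  have [->|kj] := eqVneq (k : nat) j.+1.
    by rewrite subSnn eqxx mul1n expr1 expr0 mulr1 binSn mulr_natr.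
  rewrite mulr0 (_ : (k - j == 1)%N = false) ?mul0n ?mulr0n //; lia.
rewrite subnn add0n binn muln1 (ltn_eqF (kj : (k < j.+1)%N)) mulr0 addr0.
have [->|jk] := eqVneq (j : nat) k.+1.
  by rewrite subSnn eqxx mul1n expr1 expr0 mul1r bin1 mulr_natr.
rewrite mulr0 (_ : (j - k == 1)%N = false) ?mul0n ?mulr0n //; lia.
Qed.

End PolyUnipotent.

Section Exponential.
Variable C : numDomainType.

Lemma poly0_nat_roots (p : {poly C}) : (forall k : nat, p.[k%:R] = 0) -> p = 0.
Proof.
move=> p0; apply/eqP; apply: contraT => pn0.
have := max_poly_roots (rs := [seq k%:R | k <- iota 0 (size p)]) pn0.
rewrite size_map size_iota ltnn; apply; last first.
  by rewrite map_inj_uniq ?iota_uniq // => a b /eqP; rewrite eqr_nat => /eqP.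
by apply/allP => _ /mapP[k _ ->]; rewrite /root p0.
Qed.

(* P = exp (t A) and Q = exp (t B), compared coefficient by coefficient. *)
Lemma exp_intertwine m n (c : 'M[C]_(m, n)) (A : 'M[C]_n) (B : 'M[C]_m)
    (P : 'M[{poly C}]_n) (Q : 'M[{poly C}]_m) :
  map_mx deriv P = P *m map_mx polyC A ->
  map_mx deriv Q = Q *m map_mx polyC B ->
  map_mx (horner_eval 0) P = 1%:M -> map_mx (horner_eval 0) Q = 1%:M ->
  B *m c = c *m A ->
  forall x, c *m map_mx (horner_eval x) P = map_mx (horner_eval x) Q *m c.
Proof.
move=> PA QB P0 Q0 cAB x.
have coef_succ r (S : 'M[{poly C}]_r) T k : map_mx deriv S = S *m map_mx polyC
  T ->
    k.+1%:R *: map_mx (coefp k.+1) S = map_mx (coefp k) S *m T.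
  move=> ST; apply/matrixP => i j; have /matrixP/(_ i j)/(congr1 (coefp k)) :=
    ST.
  rewrite !mxE /= coef_deriv mulr_natl => ->; rewrite coef_sum.
  by apply: eq_bigr => l _; rewrite !mxE coefMC.
have coef0 r (S : 'M[{poly C}]_r) : map_mx (horner_eval 0) S = map_mx (coefp 0)
  S.
  by apply/matrixP => i j; rewrite !mxE /horner_eval /= horner_coef0.
have cPQ k : c *m map_mx (coefp k) P = map_mx (coefp k) Q *m c.
  elim: k => [|k IHk]; first by rewrite -!coef0 P0 Q0 mulmx1 mul1mx.
  have k0 : k.+1%:R != 0 :> C by rewrite pnatr_eq0.
  suff : k.+1%:R *: (c *m map_mx (coefp k.+1) P) =
         k.+1%:R *: (map_mx (coefp k.+1) Q *m c).
    move=> e; apply/matrixP => i j; have /matrixP/(_ i j) := e.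
    by rewrite [LHS]mxE [RHS]mxE => /(mulfI k0).
  rewrite scalemxAr (coef_succ _ _ _ _ PA) scalemxAl (coef_succ _ _ _ _ QB).
  by rewrite mulmxA IHk -!mulmxA cAB.
have -> : c = map_mx (horner_eval x) (map_mx polyC c) by rewrite
  horner_const_mx.
rewrite -!map_mxM; congr map_mx.
apply/matrixP => i j; apply/polyP => k; have /matrixP/(_ i j) := cPQ k.
rewrite !mxE /= !coef_sum => e; transitivity (\sum_l c i l * (P l j)`_k).
  by apply: eq_bigr => l _; rewrite mxE coefCM.
rewrite [RHS](eq_bigr (fun l => (Q i l)`_k * c l j)); last first.
  by move=> l _; rewrite mxE coefMC.
transitivity (\sum_l c i l * map_mx (coefp k) P l j).
  by apply: eq_bigr => l _; rewrite mxE.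
by rewrite e; apply: eq_bigr => l _; rewrite mxE.
Qed.

End Exponential.

(** * Wigner matrices as exponentials of the spin matrices *)

Section Wigner.
Variable R : realType.
Local Notation C := R[i].

Definition wnorm (d : nat) : 'rV[C]_(d.+1) :=
  \row_k (Num.sqrt ((k`! * (d - k)`!)%:R : R))%:C.

Lemma wnorm_neq0 d (k : 'I_d.+1) : wnorm d 0 k != 0.
Proof.
rewrite mxE; apply/eqP => /(congr1 (@complex.Re R)) /= /eqP.
by rewrite sqrtr_eq0 lern0 muln_eq0 !gtn_eqF ?fact_gt0.
Qed.

Definition wdiag d : 'M[C]_(d.+1) := diag_mx (wnorm d).
Definition wdiagV d : 'M[C]_(d.+1) := diag_mx (map_mx GRing.inv (wnorm d)).

Lemma wdiagK d : wdiagV d *m wdiag d = 1%:M.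
Proof.
apply/matrixP => j k; rewrite mul_diag_mx !mxE; case: eqP => [->|_].
  by rewrite mulr1n mulVf //; have := wnorm_neq0 k; rewrite mxE.
by rewrite mulr0.
Qed.

Lemma wdiagVK d : wdiag d *m wdiagV d = 1%:M.
Proof. exact/mulmx1C/wdiagK. Qed.

(** The norms are complex numbers while U may have polynomial entries; f embeds the former, as
    [idfun] for points and [polyC] for curves. *)
Definition wig (K : comNzRingType) (f : {rmorphism C -> K}) d (U : 'M[K]_2) :
    'M[K]_(d.+1) :=
  map_mx f (wdiag d) *m bform d U *m map_mx f (wdiagV d).

Lemma wignerSU2E d (U : 'M[C]_2) : wignerSU2 d U = wig idfun d U.
Proof.
apply/matrixP => j k; rewrite /wig !map_mx_id // mul_diag_mx mul_mx_diag.
rewrite [LHS]mxE [RHS]mxE [(\matrix_(_, _) _) j k]mxE [bform _ _ _ _]mxE.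
rewrite [map_mx _ _ _ _]mxE mulrAC; congr (_ * _).
by rewrite !mxE sqrtrM ?ler0n // sqrtrV ?ler0n // rmorphM fmorphV.
Qed.

Section Generic.
Variables (K : comNzRingType) (f : {rmorphism C -> K}).

Lemma wig_mul d U V : wig f d (U *m V) = wig f d U *m wig f d V.
Proof.
rewrite /wig bform_mul !mulmxA.
rewrite -[_ *m map_mx f (wdiagV d) *m map_mx f (wdiag d)]mulmxA -map_mxM wdiagK.
by rewrite map_mx1 mulmx1.
Qed.

Lemma wig1 d : wig f d 1%:M = 1%:M.
Proof. by rewrite /wig bform1 mulmx1 -map_mxM wdiagVK map_mx1. Qed.

Lemma wig_scale d a U : wig f d (a *: U) = a ^+ d *: wig f d U.
Proof. by rewrite /wig bform_scale -scalemxAr -scalemxAl. Qed.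

End Generic.

Lemma map_bform (K K' : comNzRingType) (g : {rmorphism K -> K'}) d U :
  map_mx g (bform d U) = bform d (map_mx g U).
Proof.
apply/matrixP => j k; rewrite !mxE -coef_map rmorphM !rmorphXn /=.
by rewrite /lin_form !rmorphD /= !map_polyZ !map_polyX !map_polyC !mxE.
Qed.

Lemma horner_wig d (U : 'M[{poly C}]_2) x :
  map_mx (horner_eval x) (wig polyC d U) =
  wig idfun d (map_mx (horner_eval x) U).
Proof.
rewrite /wig !map_mxM map_bform !horner_const_mx.
by rewrite !map_mx_id.
Qed.

Lemma deriv_wig d (U : 'M[{poly C}]_2) :
  map_mx deriv (wig polyC d U) =
  map_mx polyC (wdiag d) *m map_mx deriv (bform d U) *m map_mx polyC (wdiagV d).
Proof. by rewrite /wig deriv_mulmx_constr deriv_mulmx_constl. Qed.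

(** Integers are written as roots so that identities between norms can be checked under a single
    root. *)
Lemma sqrt_natr_sq (m : nat) : m%:R = (Num.sqrt ((m * m)%:R : R))%:C.
Proof. by rewrite natrM -expr2 sqrtr_sqr ger0_norm ?ler0n // rmorph_nat. Qed.

Lemma wnorm_up d k : (k < d)%N ->
  spin_coef R d k * (Num.sqrt ((k`! * (d - k)`!)%:R : R))%:C =
  (Num.sqrt ((k.+1`! * (d - k.+1)`!)%:R : R))%:C * (d - k)%:R.
Proof.
move=> kd; rewrite /spin_coef sqrt_natr_sq -!rmorphM /= -!sqrtrM ?ler0n //.
rewrite -!natrM; congr (Num.sqrt _%:R)%:C.
have [e de] : exists e, (d - k = e.+1)%N by exists (d - k).-1; lia.
have -> : (d - k.+1 = e)%N by lia.
by rewrite de !factS; ring.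
Qed.

Lemma wnorm_down d k : (k < d)%N ->
  spin_coef R d k * (Num.sqrt ((k.+1`! * (d - k.+1)`!)%:R : R))%:C =
  (Num.sqrt ((k`! * (d - k)`!)%:R : R))%:C * k.+1%:R.
Proof.
move=> kd; rewrite /spin_coef sqrt_natr_sq -!rmorphM /= -!sqrtrM ?ler0n //.
rewrite -!natrM; congr (Num.sqrt _%:R)%:C.
have [e de] : exists e, (d - k = e.+1)%N by exists (d - k).-1; lia.
have -> : (d - k.+1 = e)%N by lia.
by rewrite de !factS; ring.
Qed.

Lemma spinE_bform d : spinE R d = wdiag d *m bformE C d *m wdiagV d.
Proof.
apply/matrixP => j k; rewrite mul_mx_diag mul_diag_mx !mxE.
case: eqP => [jk|_]; last by rewrite mulr0 mul0r.
have kd : (k < d)%N by have := ltn_ord j; lia.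
have := wnorm_neq0 k; rewrite mxE => n0; apply: (canRL (mulfK n0)).
by rewrite jk wnorm_up.
Qed.

Lemma spinF_bform d : spinF R d = wdiag d *m bformF C d *m wdiagV d.
Proof.
apply/matrixP => j k; rewrite mul_mx_diag mul_diag_mx !mxE.
case: eqP => [kj|_]; last by rewrite mulr0 mul0r.
have jd : (j < d)%N by have := ltn_ord k; lia.
have := wnorm_neq0 k; rewrite mxE => n0; apply: (canRL (mulfK n0)).
by rewrite kj wnorm_down.
Qed.

Lemma deriv_wig_upper d :
  map_mx deriv (wig polyC d (unip_upper 'X)) =
  wig polyC d (unip_upper 'X) *m map_mx polyC (spinE R d).
Proof.
rewrite deriv_wig deriv_bform_upper spinE_bform !map_mxM /wig !mulmxA.
rewrite -[_ *m map_mx polyC (wdiagV d) *m map_mx polyC (wdiag d)]mulmxA.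
by rewrite -map_mxM wdiagK map_mx1 mulmx1.
Qed.

Lemma deriv_wig_lower d :
  map_mx deriv (wig polyC d (unip_lower 'X)) =
  wig polyC d (unip_lower 'X) *m map_mx polyC (spinF R d).
Proof.
rewrite deriv_wig deriv_bform_lower spinF_bform !map_mxM /wig !mulmxA.
rewrite -[_ *m map_mx polyC (wdiagV d) *m map_mx polyC (wdiag d)]mulmxA.
by rewrite -map_mxM wdiagK map_mx1 mulmx1.
Qed.

Lemma horner_mx2 (p q r s : {poly C}) x :
  map_mx (horner_eval x) (mx2 p q r s) = mx2 p.[x] q.[x] r.[x] s.[x].
Proof. by apply/matrixP => i j; rewrite !mxE; do 2 case: eqP. Qed.

Section TensorProduct.
Variables (I : finType) (d : I -> nat) (L : nat).
Local Notation X := {dffun forall i : I, 'I_(d i).+1}.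
Local Notation TE := (tsum (fun i => spinE R (d i))).
Local Notation TF := (tsum (fun i => spinF R (d i))).
Local Notation TW U := (tens (fun i => wig idfun (d i) U)).
Variable c : 'M[C]_(L.+1, #|{: X}|).

Lemma deriv_tens_exp (P : forall i, 'M[{poly C}]_((d i).+1))
    (A : forall i, 'M[C]_((d i).+1)) :
  (forall i, map_mx deriv (P i) = P i *m map_mx polyC (A i)) ->
  map_mx deriv (tens P) = tens P *m map_mx polyC (tsum A).
Proof.
move=> PA; rewrite deriv_tens map_tsum /tsum mulmx_sumr; apply: eq_bigr => i _.
rewrite tens_mul; apply: eq_tens => k; rewrite /slot; case: eqP => _ //.
by rewrite mulmx1.
Qed.

Definition commutes (U : 'M[C]_2) := c *m TW U = wig idfun L U *m c.

Lemma commutes_mul U V : commutes U -> commutes V -> commutes (U *m V).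
Proof.
rewrite /commutes => cU cV; have eT : TW (U *m V) = TW U *m TW V.
  by rewrite tens_mul; apply: eq_tens => i; exact: wig_mul.
by rewrite eT wig_mul mulmxA cU -(mulmxA _ c) cV mulmxA.
Qed.

Lemma horner_tens (P : forall i, 'M[{poly C}]_((d i).+1)) x :
  map_mx (horner_eval x) (tens P) = tens (fun i => map_mx (horner_eval x) (P
    i)).
Proof. exact: map_tens. Qed.

(** Along this curve both actions are exponentials, so it suffices to intertwine the generators. *)
Lemma commutes_upper x : spinE R L *m c = c *m TE -> commutes (unip_upper x).
Proof.
have hU y k : map_mx (horner_eval y) (wig polyC k (unip_upper 'X)) =
  wig idfun k (unip_upper y).
  by rewrite horner_wig horner_mx2 !hornerE.
have tU y : map_mx (horner_eval y) (tens (fun i => wig polyC (d i) (unip_upper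
  'X))) =
    TW (unip_upper y).
  by rewrite horner_tens; apply: eq_tens => i; rewrite hU.
move=> cE; rewrite /commutes -tU -hU.
apply: (exp_intertwine _ (deriv_wig_upper L) _ _ cE).
- by apply: deriv_tens_exp => i; exact: deriv_wig_upper.
- by rewrite tU -tens1; apply: eq_tens => i; rewrite /unip_upper mx2_1 wig1.
- by rewrite hU /unip_upper mx2_1 wig1.
Qed.

Lemma commutes_lower x : spinF R L *m c = c *m TF -> commutes (unip_lower x).
Proof.
have hU y k : map_mx (horner_eval y) (wig polyC k (unip_lower 'X)) =
  wig idfun k (unip_lower y).
  by rewrite horner_wig horner_mx2 !hornerE.
have tU y : map_mx (horner_eval y) (tens (fun i => wig polyC (d i) (unip_lower
  'X))) =
    TW (unip_lower y).
  by rewrite horner_tens; apply: eq_tens => i; rewrite hU.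
move=> cF; rewrite /commutes -tU -hU.
apply: (exp_intertwine _ (deriv_wig_lower L) _ _ cF).
- by apply: deriv_tens_exp => i; exact: deriv_wig_lower.
- by rewrite tU -tens1; apply: eq_tens => i; rewrite /unip_lower mx2_1 wig1.
- by rewrite hU /unip_lower mx2_1 wig1.
Qed.

(* Upper and lower unipotent matrices generate SL_2. *)
Lemma intertwiner_commutes U : intertwiner TE TF c -> \det U = 1 -> commutes U.
Proof.
case=> cE cF; have up x := commutes_upper x cE;
  have lo x := commutes_lower x cF.
have gen (a b z e : C) : z != 0 -> a * e - b * z = 1 -> commutes (mx2 a b z e).
  move=> z0 detU.
  have -> : mx2 a b z e = unip_upper ((a - 1) / z) *m unip_lower z *m
    unip_upper ((e - 1) / z).
    have -> : b = (a * e - 1) / z by rewrite -detU; field.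
    by rewrite /unip_upper /unip_lower !mx2_mul; congr mx2; field.
  exact: (commutes_mul (commutes_mul (up _) (lo _)) (up _)).
rewrite [U]mx2E det_mx2; move: (U 0 0) (U 0 1) (U 1 0) (U 1 1) => a b z e detU.
have [z0|z0] := eqVneq z 0; last exact: gen.
have e0 : e != 0.
  apply/eqP => e0; move: detU; rewrite e0 z0 !mulr0 subr0 => /eqP.
  by rewrite eq_sym oner_eq0.
(* For z = 0 the determinant gives e <> 0, and a lower unipotent factor moves e into the lower left
   entry. *)
have -> : mx2 a b z e = mx2 (a + b) b e e *m unip_lower (-1).
  by rewrite /unip_lower mx2_mul z0; congr mx2; ring.
refine (commutes_mul (gen _ _ _ _ e0 _) (lo _)).
by rewrite -detU z0; ring.
Qed.

Lemma deriv0_wig k (x y : C) :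
  map_mx (horner_eval 0)
    (map_mx deriv (wig polyC k (mx2 1 (x *: 'X) (y *: 'X) 1))) =
  x *: spinE R k + y *: spinF R k.
Proof.
rewrite deriv_wig !map_mxM !horner_const_mx deriv0_bform spinE_bform
  spinF_bform.
by rewrite mulmxDr mulmxDl -!scalemxAr -!scalemxAl.
Qed.

End TensorProduct.
End Wigner.

(** * From commutation with SU(2) to commutation with sl_2 *)

Section Forward.
Variable R : realType.
Local Notation C := R[i].
Variables (I : finType) (d : I -> nat) (L : nat).
Local Notation X := {dffun forall i : I, 'I_(d i).+1}.
Local Notation TE := (tsum (fun i => spinE R (d i))).
Local Notation TF := (tsum (fun i => spinF R (d i))).
Local Notation TW U := (tens (fun i => wig idfun (d i) U)).
Variable c : 'M[C]_(L.+1, #|{: X}|).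

Definition su2_curve (x y : C) : 'M[{poly C}]_2 := mx2 1 (x *: 'X) (y *: 'X) 1.

Lemma horner_su2_curve x y z :
  map_mx (horner_eval z) (su2_curve x y) = mx2 1 (x * z) (y * z) 1.
Proof. by rewrite horner_mx2 !hornerE. Qed.

Lemma deriv0_tens_wig x y :
  map_mx (horner_eval 0)
    (map_mx deriv (tens (fun i => wig polyC (d i) (su2_curve x y)))) =
  x *: TE + y *: TF.
Proof.
rewrite deriv_tens raddf_sum /= -tsum_linear; apply: eq_bigr => i _.
rewrite horner_tens; apply: eq_tens => k; rewrite /slot; case: eqP => _.
  exact: deriv0_wig.
by rewrite horner_wig horner_su2_curve !mulr0 mx2_1 wig1.
Qed.

Hypothesis parity : ~~ odd (\sum_i d i + L).
Hypothesis commSU2 : forall U, SU2set U -> commutes c U.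

Definition curve_scale (s : nat) : C := ((Num.sqrt (1 + s%:R ^+ 2 : R))^-1)%:C.

Lemma curve_scale_sq s : curve_scale s * curve_scale s * (1 + s%:R ^+ 2) = 1.
Proof.
rewrite /curve_scale; set a : R := (Num.sqrt (1 + s%:R ^+ 2 : R))^-1.
have -> : 1 + s%:R ^+ 2 = (1 + s%:R ^+ 2 : R)%:C.
  by rewrite rmorphD rmorph1 rmorphXn /= rmorph_nat.
rewrite -!rmorphM /= -expr2 exprVn sqr_sqrtr;
  last by rewrite addr_ge0 ?sqr_ge0 // ler01.
by rewrite mulVf // gt_eqF // ltr_pwDl ?sqr_ge0.
Qed.

Lemma scaled_SU2 (x y : C) (s : nat) : x * y = -1 -> Num.conj y = - x ->
  SU2set (curve_scale s *: mx2 1 (x * s%:R) (y * s%:R) 1).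
Proof.
move=> xy yx; set r := curve_scale s.
have r2 : r * r * (1 + s%:R ^+ 2) = 1 by exact: curve_scale_sq.
have rr : Num.conj r = r by exact: conjc_real.
have xx : Num.conj x = - y by rewrite -[x]opprK -yx rmorphN /= conjCK.
have ss : Num.conj (s%:R : C) = s%:R by rewrite rmorph_nat.
have -> : r *: mx2 1 (x * s%:R) (y * s%:R) 1 =
    mx2 r (r * (x * s%:R)) (r * (y * s%:R)) r.
  by rewrite [LHS]mx2E !mxE /= !mulr1.
have rxy : r * (x * s%:R) * (r * (y * s%:R)) = - (r * r * s%:R ^+ 2).
  by rewrite -[RHS]mulN1r -xy; ring.
have r1 : r * r + r * r * s%:R ^+ 2 = 1 by rewrite -[RHS]r2; ring.
split; last by rewrite det_mx2 rxy opprK.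
apply/unitarymxP.
have -> : (mx2 r (r * (x * s%:R)) (r * (y * s%:R)) r)^t*%sesqui =
    mx2 r (- (r * (x * s%:R))) (- (r * (y * s%:R))) r.
  rewrite [LHS]mx2E !mxE /= !rmorphM /= rr xx ss yx.
  by congr mx2; ring.
have ryx : r * (y * s%:R) * (r * (x * s%:R)) = - (r * r * s%:R ^+ 2).
  by rewrite mulrC.
rewrite mx2_mul -mx2_1 !mulrN rxy ryx !opprK r1 [_ + r * r]addrC r1.
by congr mx2; ring.
Qed.

(** Multiplication by r^S makes both powers of r even, since S + L = 2 h; then r^2 = 1 / rho removes
    the square root. *)
Lemma cancel_scale (K : fieldType) (r rho u v : K) (S h : nat) :
  r * r * rho = 1 -> (S + L = h.*2)%N -> r ^+ S * u = r ^+ L * v ->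
  rho ^+ h * u = rho ^+ S * v.
Proof.
move=> r2 SL uv; have r0 : r ^+ S != 0.
  rewrite expf_eq0 negb_and; apply/orP; right; apply/eqP => r0.
  by move/eqP: r2; rewrite r0 !mul0r eq_sym oner_eq0.
have e : r ^+ S * r ^+ L = (r * r) ^+ h by rewrite -exprD SL -muln2 mulnC exprM.
apply: (mulfI r0); apply: (mulfI r0); transitivity v.
  transitivity (rho ^+ h * r ^+ S * (r ^+ S * u)); first by ring.
  rewrite uv mulrA -[_ * r ^+ L]mulrA e mulrC -exprMn [rho * _]mulrC r2 expr1n.
  exact: mulr1.
by rewrite !mulrA -!exprMn r2 expr1n mul1r.
Qed.

Lemma poly_commutes x y : x * y = -1 -> Num.conj y = - x ->
  c *m (x *: TE + y *: TF) = (x *: spinE R L + y *: spinF R L) *m c.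
Proof.
move=> xy yx; set S := (\sum_i d i)%N; have [h hE] : exists h, (S + L = h.*2)%N.
  by exists (S + L)./2; rewrite -[LHS]odd_double_half (negPf parity).
pose rho : {poly C} := 1 + 'X ^+ 2.
pose P := tens (fun i => wig polyC (d i) (su2_curve x y)).
pose Q := wig polyC L (su2_curve x y).
have PQ : rho ^+ h *: (map_mx polyC c *m P) = rho ^+ S *: (Q *m map_mx polyC c).
  apply/matrixP => a b; apply/eqP; rewrite -subr_eq0;
    apply/eqP/poly0_nat_roots => s.
  have := commSU2 (scaled_SU2 s xy yx); rewrite /commutes; set M := mx2 _ _ _ _.
  have -> : TW (curve_scale s *: M) = curve_scale s ^+ S *: TW M.
    by rewrite -prodrXr -tens_scale; apply: eq_tens => i; exact: wig_scale.
  rewrite wig_scale -scalemxAr -scalemxAl => /matrixP/(_ a b).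
  rewrite [LHS]mxE [RHS]mxE => /(cancel_scale (curve_scale_sq s) hE).
  have -> : (c *m TW M) a b = ((map_mx polyC c *m P) a b).[s%:R].
    transitivity (map_mx (horner_eval s%:R) (map_mx polyC c *m P) a b).
      rewrite map_mxM horner_const_mx horner_tens;
        congr (fun_of_matrix (_ *m _) _ _).
      by apply: eq_tens => i; rewrite horner_wig horner_su2_curve.
    by rewrite mxE.
  have -> : (wig idfun L M *m c) a b = ((Q *m map_mx polyC c) a b).[s%:R].
    transitivity (map_mx (horner_eval s%:R) (Q *m map_mx polyC c) a b).
      by rewrite map_mxM horner_const_mx horner_wig horner_su2_curve.
    by rewrite mxE.
  have sc (p : {poly C}) (A : 'M[{poly C}]_(L.+1, #|{: X}|)) :
    (p *: A) a b = p * A a b by rewrite mxE.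
  move=> e; rewrite hornerD hornerN !sc !hornerM.
  rewrite !horner_exp /rho hornerD hornerXn hornerC.
  by rewrite e subrr.
(* rho (0) = 1 and rho' (0) = 0, so the powers of rho leave no trace in the derivative at 0. *)
have d0 m n (k : nat) (A : 'M[{poly C}]_(m, n)) :
    map_mx (horner_eval 0) (map_mx deriv (rho ^+ k *: A)) =
    map_mx (horner_eval 0) (map_mx deriv A).
  apply/matrixP => a b; rewrite !mxE /horner_eval derivM hornerD !hornerM.
  have r1 : rho.[0] = 1 by rewrite /rho hornerD hornerC hornerXn expr0n addr0.
  have r0 : (deriv rho).[0] = 0.
    by rewrite /rho derivD derivC add0r derivXn hornerMn hornerX mul0rn.
  rewrite deriv_exp hornerMn hornerM r0 !mul0r mul0rn mul0r add0r.
  by rewrite horner_exp r1 expr1n mul1r.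
have := congr1 (fun A => map_mx (horner_eval 0) (map_mx deriv A)) PQ.
rewrite /= !d0 deriv_mulmx_constl deriv_mulmx_constr !map_mxM !horner_const_mx.
by rewrite deriv0_tens_wig deriv0_wig.
Qed.

(** The parameters (-1, 1) and (i, i) give the tangent directions F - E and i (E + F) of SU(2),
    whose complex span contains E and F. *)
Lemma commutes_intertwiner : intertwiner TE TF c.
Proof.
have h1 : c *m TF - c *m TE = spinF R L *m c - spinE R L *m c.
  have := @poly_commutes (-1) 1 (mulN1r 1); rewrite rmorph1 opprK => /(_ erefl).
  by rewrite !scaleN1r !scale1r mulmxDr mulmxDl mulmxN mulNmx ![- _ + _]addrC.
have h2 : c *m TF + c *m TE = spinF R L *m c + spinE R L *m c.
  have := @poly_commutes 'i 'i; rewrite -expr2 sqrCi conjCi => /(_ erefl erefl).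
  rewrite -!scalerDr -scalemxAr -scalemxAl => /(scalerI (neq0Ci C)).
  by rewrite mulmxDr mulmxDl ![c *m TE + _]addrC ![spinE R L *m c + _]addrC.
have two (A A' B B' : 'M[C]_(L.+1, #|{: X}|)) :
    A - B = A' - B' -> A + B = A' + B' -> A = A' /\ B = B'.
  move=> AB AB'; have e : A = A'.
    have n2 : (2%:R : C) != 0 by rewrite pnatr_eq0.
    apply: (scalerI n2); rewrite !scaler_nat !mulr2n.
    have -> : A + A = (A - B) + (A + B) by rewrite addrACA addNr addr0.
    by rewrite AB AB' addrACA addNr addr0.
  by split=> //; move: AB'; rewrite e => /addrI.
by have [hF hE] := two _ _ _ _ h1 h2; split; exact: esym.
Qed.

End Forward.

(** * The commutant of SU(2) and weight multiplicities *)

Section Dimension.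
Variable R : realType.
Local Notation C := R[i].
Variables (I : finType) (d : I -> nat) (L : nat).
Local Notation X := {dffun forall i : I, 'I_(d i).+1}.
Local Notation TE := (tsum (fun i => spinE R (d i))).
Local Notation TF := (tsum (fun i => spinF R (d i))).

(* The vectors of weight sum_i (2 x_i - d_i) = a, without subtraction. *)
Definition weight_count (a : nat) : nat :=
  #|[pred x : X | \sum_i (x i).*2 == a + \sum_i d i]|%N.

Definition total_weight : 'rV[C]_#|{: X}| :=
  \row_a \sum_i spin_weight R (d i) 0 ((enum_val a : X) i).

Lemma tsum_spin_weight :
  tsum (fun i => diag_mx (spin_weight R (d i))) = diag_mx total_weight.
Proof. by apply/matrixP => a b; rewrite tsum_diag !mxE. Qed.

Lemma card_total_weight a :
  #|[pred j | total_weight 0 j == a%:R]| = weight_count a.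
Proof.
rewrite /weight_count -[LHS]sum1_card -[RHS]sum1_card [RHS](reindex (@enum_val
  X predT)); last first.
  exact/onW_bij/enum_val_bij.
apply: eq_bigl => j; rewrite !inE mxE.
rewrite (eq_bigr (fun i => (((enum_val j : X) i).*2)%:R - (d i)%:R)) => [|i _];
  last first.
  by rewrite mxE.
by rewrite sumrB -!natr_sum subr_eq -natrD eqr_nat.
Qed.

Lemma dim_commutant : ~~ odd (\sum_i d i + L) ->
  exists m : nat, (m + weight_count L.+2 = weight_count L)%N /\
    has_dimension [set c : 'M[C]_(L.+1, #|{: X}|) |
                    forall U, SU2set U -> commutes c U]%classic m.
Proof.
move=> parity; have [] := @dim_intertwiner R _ TE TF total_weight _ _ _ _ L.
- rewrite map_tsum tr_tsum; apply: eq_tsum => i; exact: spin_adjoint.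
- rewrite tsum_commutator -tsum_spin_weight; apply: eq_tsum => i;
  exact: spin_commEF.
- rewrite -tsum_spin_weight tsum_commutator -tsumZ; apply: eq_tsum => i;
  exact: spin_commHE.
- rewrite -tsum_spin_weight tsum_commutator -scaleNr -tsumZ;
  apply: eq_tsum => i.
  by rewrite spin_commHF scaleNr.
move=> m; rewrite !card_total_weight => -[mE [b [bfree bgen]]].
exists m; split=> //; exists b; split=> // c; rewrite -bgen /=; split.
  exact: commutes_intertwiner.
by move=> cEF U [_ detU]; apply: intertwiner_commutes.
Qed.

Lemma commutes_scale (a : C) (c : 'M[C]_(L.+1, #|{: X}|)) (U : 'M[C]_2) :
  a != 0 -> a ^+ (\sum_i d i)%N = a ^+ L -> commutes c (a *: U) -> commutes c U.
Proof.
move=> a0 aSL; rewrite /commutes => cU.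
have e : tens (fun i => wig idfun (d i) (a *: U)) =
    a ^+ L *: tens (fun i => wig idfun (d i) U).
  by rewrite -aSL -prodrXr -tens_scale; apply: eq_tens => i; exact: wig_scale.
have aL0 : a ^+ L != 0 by rewrite expf_eq0 (negPf a0) andbF.
rewrite e wig_scale in cU; apply: (scalerI aL0).
transitivity (c *m (a ^+ L *: tens (fun i => wig idfun (d i) U))).
  exact: scalemxAr.
by rewrite cU; symmetry; exact: scalemxAl.
Qed.

(** The matrix - 1 acts by (-1)^(\sum d_i) on one side and by (-1)^L on the other; parity makes the
    signs equal. This absorbs the ambiguous sign of a lift from SO(3). *)
Lemma commutes_opp (c : 'M[C]_(L.+1, #|{: X}|)) (U : 'M[C]_2) :
  ~~ odd (\sum_i d i + L) -> commutes c (-1 *: U) -> commutes c U.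
Proof.
move=> parity; apply: commutes_scale; first by rewrite oppr_eq0 oner_eq0.
by rewrite -(signr_odd _ L) -(signr_odd _ (\sum_i _)); move: parity;
  rewrite oddD; case: (odd L) (odd _) => -[].
Qed.

End Dimension.

(** * The double cover of SO(3) *)

Section SpinCover.
Variable R : realType.
Local Notation C := R[i].

Definition quat (x y z w : R) : 'M[C]_2 :=
  mx2 (x +i* y) (z +i* w) (- z +i* w) (x -i* y).

(* U sigma_j U^* = \sum_k R_kj sigma_k for U = quat x y z w. *)
Definition rotation_entry (x y z w : R) (k j : nat) : R :=
  match k, j with
  | 0%N, 0%N => x * x - y * y - z * z + w * w
  | 0%N, 1%N => 2 * (x * y + z * w)
  | 0%N, _ => - 2 * (x * z - y * w)
  | 1%N, 0%N => - 2 * (x * y - z * w)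
  | 1%N, 1%N => x * x - y * y + z * z - w * w
  | 1%N, _ => 2 * (x * w + y * z)
  | _, 0%N => 2 * (x * z + y * w)
  | _, 1%N => - 2 * (x * w - y * z)
  | _, _ => x * x + y * y - z * z - w * w
  end.

Definition rotation (x y z w : R) : 'M[R]_3 :=
  \matrix_(k, j) rotation_entry x y z w k j.

Lemma adjoint_mx2 (a b c e : C) :
  ((mx2 a b c e) ^t*)%sesqui = mx2 a^* c^* b^* e^*.
Proof. by rewrite [LHS]mx2E !mxE. Qed.

(** As det U = 1 the inverse is the adjugate, and unitarity equates it with the adjoint. *)
Lemma SU2_quat (U : 'M[C]_2) : SU2set U ->
  exists x y z w, x * x + y * y + z * z + w * w = 1 /\ U = quat x y z w.
Proof.
case=> /unitarymxP; rewrite [U]mx2E; move: (U 0 0) (U 0 1) (U 1 0) (U 1 1).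
move=> a b c e UU; rewrite det_mx2 => detU.
have inv : mx2 e (- b) (- c) a *m mx2 a b c e = 1%:M.
  by rewrite mx2_mul -mx2_1 -detU; congr mx2; ring.
have : ((mx2 a b c e) ^t*)%sesqui = mx2 e (- b) (- c) a.
  by rewrite -[RHS]mulmx1 -UU mulmxA inv mul1mx.
rewrite adjoint_mx2 => adj.
have eE : e = a^* by have /matrixP/(_ 0 0) := adj; rewrite !mxE.
have cE : c = - b^*.
  by have /matrixP/(_ 1 0) := adj; rewrite !mxE /= => ->; rewrite opprK.
rewrite {}cE {}eE in detU *; move: a b detU {UU inv adj} => [x y] [z w] /= detU.
exists x, y, z, w; split; last by rewrite /quat; congr mx2; simpc.
by move/(congr1 (@complex.Re R)): detU => /=; rewrite !mulrN !opprK => <-; ring.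
Qed.

Lemma mxtrace_mx2 (a b c e : C) : \tr (mx2 a b c e) = a + e.
Proof. by rewrite /mxtrace !big_ord_recl big_ord0 addr0 !mxE. Qed.

Lemma Re_half (t : C) : complex.Re (t / 2) = complex.Re t / 2.
Proof.
have -> : (2%:R : C)^-1 = (2^-1 : R)%:C by rewrite fmorphV /= rmorph_nat.
by case: t => p q; simpc.
Qed.

Lemma spin_cover_quat x y z w : spin_cover (quat x y z w) = rotation x y z w.
Proof.
(* All constants are brought to the form p +i* q, so that each trace reduces to a real polynomial
   identity. *)
have c0 : 0 = 0 +i* 0 :> C by [].
have c1 : 1 = 1 +i* 0 :> C by [].
have ci : 'i = 0 +i* 1 :> C by rewrite complexiE.
have p0 : pauli R (inord 0) = mx2 (0 +i* 0) (1 +i* 0) (1 +i* 0) (0 +i* 0).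
  by rewrite [LHS]mx2E !mxE inordK.
have p1 : pauli R (inord 1) = mx2 (0 +i* 0) (- (0 +i* 1)) (0 +i* 1) (0 +i* 0).
  by rewrite [LHS]mx2E !mxE inordK // ci.
have p2 : pauli R (inord 2) = mx2 (1 +i* 0) (0 +i* 0) (0 +i* 0) (- (1 +i* 0)).
  by rewrite [LHS]mx2E !mxE inordK // expr0 expr1.
have cM (p q r s : R) : (p +i* q) * (r +i* s) = (p * r - q * s) +i* (p * s +
  q * r) by [].
have cD (p q r s : R) : (p +i* q) + (r +i* s) = (p + r) +i* (q + s) by [].
have cN (p q : R) : - (p +i* q) = (- p) +i* (- q) by [].
have cC (p q : R) : (p +i* q)^* = p -i* q by [].
apply/matrixP => k j; rewrite !mxE -[in LHS](inord_val k) -[in LHS](inord_val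
  j).
rewrite Re_half.
case: k j => -[|[|[|//]]] ik [[|[|[|//]]] ij] /=;
  rewrite ?p0 ?p1 ?p2 /quat adjoint_mx2 !mx2_mul mxtrace_mx2 !(cM, cD, cN,
    cC) /=.
all: by field.
Qed.

(** For arbitrary x, y, z, w of squared norm n one has A A^T = n^2 and det A = n^3; these are
    polynomial identities, specialized to n = 1. *)
Lemma rotation_SO3 x y z w : x * x + y * y + z * z + w * w = 1 ->
  SO3set (rotation x y z w).
Proof.
set n := (X in X = 1 -> _) => n1; split.
  have -> : 1%:M = (n * n) *: 1%:M :> 'M[R]_3 by rewrite n1 mulr1 scale1r.
  apply/matrixP => k j; rewrite !mxE !big_ord_recl big_ord0 !mxE /n.
  by case: k j => -[|[|[|//]]] ik [[|[|[|//]]] ij] /=; ring.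
have d2 (B : 'M[R]_2) : \det B = B 0 0 * B 1 1 - B 0 1 * B 1 0.
  by rewrite [B]mx2E det_mx2 !mxE.
rewrite (expand_det_row _ 0) !big_ord_recl big_ord0 /cofactor !d2 !mxE /=.
transitivity (n * n * n); last by rewrite n1 !mulr1.
by rewrite /n; ring.
Qed.

(** The entries and the norm determine all products of two coordinates, that is the rank one matrix
    q q^T, and hence q up to the sign s = <q, q'>. *)
Lemma rotation_inj x y z w x' y' z' w' :
  x * x + y * y + z * z + w * w = 1 ->
  x' * x' + y' * y' + z' * z' + w' * w' = 1 ->
  rotation x y z w = rotation x' y' z' w' ->
  quat x' y' z' w' = quat x y z w \/ quat x' y' z' w' = - quat x y z w.
Proof.
move=> n1 n1' /matrixP rr.
have r i j : (i < 3)%N -> (j < 3)%N ->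
    rotation_entry x y z w i j = rotation_entry x' y' z' w' i j.
  by move=> i3 j3; have := rr (Ordinal i3) (Ordinal j3); rewrite !mxE.
have := (r 0 0 isT isT, r 0 1 isT isT, r 0 2 isT isT)%N.
have := (r 1 0 isT isT, r 1 1 isT isT, r 1 2 isT isT)%N.
have := (r 2 0 isT isT, r 2 1 isT isT, r 2 2 isT isT)%N.
rewrite /= => -[[r20 r21] r22] [[r10 r11] r12] [[r00 r01] r02].
have exx : x * x = x' * x' by lra.
have eyy : y * y = y' * y' by lra.
have ezz : z * z = z' * z' by lra.
have eww : w * w = w' * w' by lra.
have exy : x * y = x' * y' by lra.
have exz : x * z = x' * z' by lra.
have exw : x * w = x' * w' by lra.
have eyz : y * z = y' * z' by lra.
have eyw : y * w = y' * w' by lra.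
have ezw : z * w = z' * w' by lra.
pose s := x * x' + y * y' + z * z' + w * w'.
have sx : s * x = x'.
  transitivity (x * x * x' + x * y * y' + x * z * z' + x * w * w');
    first by rewrite /s; ring.
  by rewrite exx exy exz exw -[RHS]mulr1 -n1'; ring.
have sy : s * y = y'.
  transitivity (x * y * x' + y * y * y' + y * z * z' + y * w * w');
    first by rewrite /s; ring.
  by rewrite eyy exy eyz eyw -[RHS]mulr1 -n1'; ring.
have sz : s * z = z'.
  transitivity (x * z * x' + y * z * y' + z * z * z' + z * w * w');
    first by rewrite /s; ring.
  by rewrite ezz exz eyz ezw -[RHS]mulr1 -n1'; ring.
have sw : s * w = w'.
  transitivity (x * w * x' + y * w * y' + z * w * z' + w * w * w');
    first by rewrite /s; ring.
  by rewrite eww exw eyw ezw -[RHS]mulr1 -n1'; ring.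
have s2 : s ^+ 2 = 1.
  rewrite expr2 -[RHS]n1' -{1}sx -{1}sy -{1}sz -{1}sw /s; ring.
have /orP[/eqP s1|/eqP s1] : (s == 1) || (s == -1) by rewrite -sqrf_eq1 s2.
  by left; rewrite -sx -sy -sz -sw s1 !mul1r.
right; rewrite -sx -sy -sz -sw s1 !mulN1r.
by apply/matrixP => p q; rewrite !mxE; do 2 case: eqP => _; simpc;
  rewrite ?opprK.
Qed.

(** The rotation is the image of U itself, so the choice in [lift_rotation] has a witness; two lifts
    of one rotation differ by a sign. *)
Lemma lift_rotation_cover (U : 'M[C]_2) : SU2set U ->
  exists A : 'M[R]_3, [/\ SO3set A, SU2set (lift_rotation A) &
    lift_rotation A = U \/ lift_rotation A = - U].
Proof.
move=> SU; have [x [y [z [w [n1 UE]]]]] := SU2_quat SU.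
exists (rotation x y z w); split; first exact: rotation_SO3.
  rewrite /lift_rotation; case: xgetP => [V -> []//|/(_ U) []].
  by split=> //; rewrite UE spin_cover_quat.
rewrite /lift_rotation; case: xgetP => [V _ [SV]|/(_ U) []]; last first.
  by split=> //; rewrite UE spin_cover_quat.
have [x' [y' [z' [w' [n1' ->]]]]] := SU2_quat SV.
rewrite spin_cover_quat UE => e; exact: rotation_inj.
Qed.

End SpinCover.

(** * Linear independence of product functions *)

Section Separation.
Variables (K : fieldType) (F : lmodType K).
Local Open Scope classical_set_scope.

(** A maximal subspace A avoiding v is a complement of the line through v, and f reads off the
    coefficient of v. *)
Lemma exists_scalar_neq0 (v : F) : v != 0 -> exists f : {scalar F}, f v != 0.
Proof.
move=> v0.
pose P (A : set F) := (forall a x y, A x -> A y -> A (a *: x + y)) /\ ~ A v.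
have [|A [[Alin Av] Amax]] := @Zorn_bigcup F P.
  move=> S SP Stot; split=> [a x y [X SX Xx] [Y SY Yy]|[X /SP[_ Xv]] //].
  have [XY|YX] := Stot _ _ SX SY.
    by exists Y => //; apply: (SP _ SY).1 => //; exact: XY.
  by exists X => //; apply: (SP _ SX).1 => //; exact: YX.
(* The empty set also satisfies [P], so A is nonempty only by maximality, compared with {0}. *)
have A0 : A 0.
  have [x Ax] : A !=set0.
    apply/set0P/eqP => A0; apply: (Amax [set 0]).
      by rewrite A0; split=> // /(_ 0); apply.
    split=> [a x y -> ->|/= /eqP]; first by rewrite /= scaler0 addr0.
    by rewrite (negPf v0).
  by rewrite -(addNr x) -scaleN1r; exact: Alin.
have AZ a x : A x -> A (a *: x) by move=> Ax; rewrite -[_ *: _]addr0;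
  exact: Alin.
have AB x y : A x -> A y -> A (x - y).
  by move=> Ax Ay; rewrite addrC -scaleN1r; exact: Alin.
(* If u is not in A, the larger subspace spanned by A and u contains v, so v - b u is in A; here b
   <> 0 since v is not in A. *)
have Adec u : exists a, A (u - a *: v).
  have [Au|nAu] := pselect (A u); first by exists 0; rewrite scale0r subr0.
  pose B := [set x | exists b, A (x - b *: u)].
  have nPB : ~ P B.
    apply: Amax; split=> [x Ax|BA]; first by exists 0; rewrite scale0r subr0.
    by apply: nAu; apply: BA; exists 1; rewrite scale1r subrr.
  have [b Ab] : B v.
    apply: contrapT => nBv; apply: nPB; split=> // a x y [b Ab] [b' Ab'].
    exists (a * b + b'); rewrite scalerDl -scalerA opprD addrACA -scalerBr.
    exact: Alin.
  have b0 : b != 0.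
    by apply/eqP => b0; apply: Av; move: Ab; rewrite b0 scale0r subr0.
  exists b^-1; have := AZ (- b^-1) _ Ab.
  by rewrite scaleNr scalerBr scalerA mulVf // scale1r opprB.
have Auniq u a b : A (u - a *: v) -> A (u - b *: v) -> a = b.
  move=> ua ub; apply/eqP; rewrite -subr_eq0; apply/negP => /negP ab; apply: Av.
  have e : u - b *: v - (u - a *: v) = (a - b) *: v.
    by rewrite scalerBl opprB addrC addrA subrK.
  by have := AZ (a - b)^-1 _ (AB _ _ ub ua); rewrite e scalerA mulVf ?scale1r.
pose f u := projT1 (cid (Adec u)).
have fP u : A (u - f u *: v) by rewrite /f; case: cid.
have flin : scalar f.
  move=> a x y; apply: (Auniq (a *: x + y)) => //.
  by rewrite scalerDl -scalerA opprD addrACA -scalerBr; exact: Alin.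
pose flin' := GRing.isLinear.Build K F K^o *%R f flin.
pose g : {scalar F} := HB.pack f flin'.
exists g; have -> : g v = 1; last exact: oner_neq0.
by apply: (Auniq v) => //; rewrite scale1r subrr.
Qed.

End Separation.

Section DualPoints.
Variables (K : fieldType) (T : Type) (n : nat) (g : 'I_n -> T -> K).
Hypothesis g_free : forall a : 'I_n -> K,
  (forall t, \sum_j a j * g j t = 0) -> forall j, a j = 0.

(** With fewer than n points, some a <> 0 is orthogonal to all rows; freeness gives a point t where
    \sum a_j g_j (t) <> 0, and its row is independent of the others. *)
Lemma free_points r : (r <= n)%N ->
  exists p : 'I_r -> T, row_free (\matrix_(i < r, j < n) g j (p i)).
Proof.
elim: r => [|r IHr] rn.
  have p (i : 'I_0) : T by case: i.
  by exists p; rewrite -row_leq_rank.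
have [p] := IHr (ltnW rn); set M := \matrix_(_, _) _ => Mfree.
have [a [a0 Ma]] : exists a : 'rV[K]_n, a != 0 /\ M *m a^T = 0.
  have /rowV0Pn[a aker a0] : kermx M^T != 0.
    by rewrite kermx_eq0 -row_leq_rank mxrank_tr -ltnNge (leq_ltn_trans
      (rank_leq_row M)).
  by exists a; split=> //; apply: trmx_inj; rewrite trmx_mul trmxK trmx0;
    exact/sub_kermxP.
have [t at0] : exists t, \sum_j a 0 j * g j t != 0.
  apply: contrapT => /forallNP h; case/eqP: a0; apply/rowP => j; rewrite mxE.
  by apply: (@g_free (fun j => a 0 j)) => t; have /negP := h t;
    rewrite negbK => /eqP.
exists (fun i => if unlift ord_max i is Some k then p k else t).
rewrite -kermx_eq0; apply/rowV0P => u /sub_kermxP uN.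
have uE j : u 0 ord_max * g j t + \sum_(i < r) u 0 (lift ord_max i) * g j (p i)
  = 0.
  have /rowP/(_ j) := uN; rewrite !mxE (bigD1_ord ord_max) //= => e.
  rewrite -[RHS]e mxE unlift_none; congr (_ + _); apply: eq_bigr => i _.
  by rewrite mxE liftK.
have umax : u 0 ord_max = 0.
  apply: (mulIf at0); rewrite mul0r mulr_sumr.
  transitivity (\sum_j a 0 j *
      (u 0 ord_max * g j t + \sum_(i < r) u 0 (lift ord_max i) * g j (p i))).
    under [RHS]eq_bigr do rewrite mulrDr mulr_sumr.
    rewrite big_split /= exchange_big /= [X in _ = _ + X]big1 => [|i _].
      by rewrite addr0; apply: eq_bigr => j _; rewrite mulrCA.
    have /matrixP/(_ i 0) := Ma; rewrite !mxE => e.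
    transitivity (u 0 (lift ord_max i) * \sum_j M i j * a^T j 0).
      by rewrite mulr_sumr; apply: eq_bigr => j _;
        rewrite !mxE mulrCA [a 0 j * _]mulrC.
    by rewrite e mulr0.
  by apply: big1 => j _; rewrite uE mulr0.
have u0 : \row_i u 0 (lift ord_max i) = 0 :> 'rV_r.
  apply/eqP; rewrite -submx0 -(eqP (_ : kermx M == 0));
    last by rewrite kermx_eq0.
  apply/sub_kermxP/rowP => j; rewrite !mxE -[RHS](uE j) umax mul0r add0r.
  by apply: eq_bigr => i _; rewrite !mxE.
apply/rowP => i; rewrite mxE; case: (unliftP ord_max i) => [k ->|-> //].
by have /rowP/(_ k) := u0; rewrite !mxE.
Qed.

Lemma dual_points : exists (p : 'I_n -> T) (a : 'M[K]_n),
  forall k j, \sum_i a k i * g j (p i) = (k == j)%:R.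
Proof.
have [p Mfree] := free_points (leqnn n); set M := \matrix_(_, _) _ in Mfree.
exists p, (invmx M) => k j; have Mu : M \in unitmx by rewrite -row_free_unit.
have /matrixP/(_ k j) := mulVmx Mu; rewrite !mxE => <-.
by apply: eq_bigr => i _; rewrite mxE.
Qed.

End DualPoints.

(** Each family has dual combinations of point evaluations; their product over i extracts the
    coefficient c m0. *)
Lemma prod_free (K : fieldType) (I : finType) (d : I -> nat) (T : I -> Type)
    (g : forall i, 'I_(d i).+1 -> T i -> K)
    (c : {dffun forall i : I, 'I_(d i).+1} -> K) :
  (forall i (a : 'I_(d i).+1 -> K),
     (forall t, \sum_j a j * g i j t = 0) -> forall j, a j = 0) ->
  (forall t : forall i, T i, \sum_m c m * \prod_i g i (m i) (t i) = 0) ->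
  forall m, c m = 0.
Proof.
move=> gfree c0 m0.
have exp i : exists p : ('I_(d i).+1 -> T i) * 'M[K]_((d i).+1),
    forall k j, \sum_s p.2 k s * g i j (p.1 s) = (k == j)%:R.
  by have [p [a pa]] := dual_points (gfree i); exists (p, a).
pose p i := projT1 (cid (exp i)).
have pP i : forall k j, \sum_s (p i).2 k s * g i j ((p i).1 s) = (k == j)%:R.
  by rewrite /p; case: cid.
have sumE (m : {dffun forall i : I, 'I_(d i).+1}) : \sum_(s : {dffun forall i :
  I, 'I_(d i).+1})
    (\prod_i (p i).2 (m0 i) (s i)) * \prod_i g i (m i) ((p i).1 (s i)) =
    (m == m0)%:R.
  under eq_bigr do rewrite -big_split /=.
  rewrite -(prod_sum_dffun (fun i s => (p i).2 (m0 i) s * g i (m i) ((p i).1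
    s))).
  under eq_bigr do rewrite pP.
  have [->|mm0] := eqVneq m m0; first by rewrite big1 // => i _; rewrite eqxx.
  have [i mi] : exists i, m i != m0 i.
    apply/existsP; rewrite -negb_forall; apply: contra mm0 => /forallP e.
    by apply/eqP/ffunP => i; exact: (eqP (e i)).
  by rewrite (bigD1 i) //= eq_sym (negPf mi) mul0r.
have : \sum_(s : {dffun forall i : I, 'I_(d i).+1})
    (\prod_i (p i).2 (m0 i) (s i)) *
    \sum_m c m * \prod_i g i (m i) ((p i).1 (s i)) = 0.
  by apply: big1 => s _; rewrite (c0 (fun i => (p i).1 (s i))) mulr0.
under eq_bigr do rewrite mulr_sumr.
rewrite exchange_big /= (eq_bigr (fun m => c m * (m == m0)%:R)) => [|m _].
  rewrite (bigD1 m0) //= big1 ?addr0 ?eqxx ?mulr1 // => m /negPf ->.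
  exact: mulr0.
by rewrite -sumE mulr_sumr; apply: eq_bigr => s _; rewrite mulrCA.
Qed.

(** * The space of equivariant functions *)

Lemma has_dimension_image (K : fieldType) (V V' : lmodType K) (W : set V)
    (W' : set V') (h : V -> V') (m : nat) :
  (forall a x y, h (a *: x + y) = a *: h x + h y) ->
  (forall x, h x = 0 -> x = 0) ->
  (forall y, W' y <-> exists2 x, W x & y = h x) ->
  has_dimension W m -> has_dimension W' m.
Proof.
move=> hlin hinj hW [b [bfree bgen]].
have h0 : h 0 = 0 by have := hlin (-1) 0 0; rewrite !scaleN1r oppr0 add0r addNr.
have hsum (c : 'I_m -> K) : h (\sum_i c i *: b i) = \sum_i c i *: h (b i).
  rewrite (big_morph h (id1 := 0) (op1 := +%R)) //.
    by apply: eq_bigr => i _; rewrite -[c i *: b i]addr0 hlin h0 addr0.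
  by move=> x y; have := hlin 1 x y; rewrite !scale1r.
exists (fun i => h (b i)); split=> [c|y].
  by rewrite -hsum => /hinj/bfree.
rewrite hW; split=> [[x /bgen[c ->] ->]|[c ->]]; first by exists c;
  rewrite hsum.
by exists (\sum_i c i *: b i); [apply/bgen; exists c|rewrite hsum].
Qed.

Definition glift (R : realType) (G : rotgroup) : gmx R G -> 'M[R[i]]_2 :=
  match G with
  | SU2 => fun U => U
  | SO3 => fun A => lift_rotation A
  end.

Lemma wignerD_glift (R : realType) (G : rotgroup) d (Q : gmx R G) :
  wignerD d Q = wig idfun d (glift Q).
Proof. by case: G Q => Q; exact: wignerSU2E. Qed.

Section InnerProduct.
Variables (R : realType) (V : lmodType R[i]) (H : set V) (ip : V -> V -> R[i]).
Hypothesis hip : inner_product_on H ip.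

Lemma ip_sum m (a : 'I_m -> R[i]) (v : 'I_m -> V) (u : V) :
  (forall i, H (v i)) -> H u ->
  ip (\sum_i a i *: v i) u = \sum_i a i * ip (v i) u.
Proof.
move: hip => [H0 Hlin iplin _ _] Hv Hu.
have ip0 : ip 0 u = 0.
  have := iplin 1 0 0 u H0 H0 Hu; rewrite scaler0 addr0 mul1r.
  by move/eqP; rewrite -subr_eq subrr => /eqP.
suff [] : H (\sum_i a i *: v i) /\
    ip (\sum_i a i *: v i) u = \sum_i a i * ip (v i) u by [].
elim/big_rec2: _ => // i y x _ [Hx IH]; split; first exact: Hlin.
by rewrite iplin // IH.
Qed.

End InnerProduct.

Section Equivariant.
Variables (R : realType) (G : rotgroup) (F : lmodType R[i]) (Omega J : Type).
Variables (act : gmx R G -> Omega -> Omega).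
Hypothesis hact : group_action act.
Variables (H : set (Omega -> F)) (ip : (Omega -> F) -> (Omega -> F) -> R[i]).
Hypothesis hip : inner_product_on H ip.
Variables (deg : J -> nat) (phi : forall l : J, 'I_(deg l).+1 -> Omega -> F).
Arguments phi : clear implicits.
Hypothesis hphi : forall l m, H (phi l m).
Hypothesis horth : forall l m m', ip (phi l m) (phi l m') = (m == m')%:R.
Hypothesis htrans : forall l m Q, gset Q -> forall r,
  phi l m (act Q r) = \sum_m' wignerD (deg l) Q m m' *: phi l m' r.
Arguments hphi : clear implicits.

Lemma phi_free l (a : 'I_(deg l).+1 -> R[i]) :
  (forall r, \sum_j a j *: phi l j r = 0) -> forall j, a j = 0.
Proof.
move=> a0 k.
have e : \sum_j a j *: phi l j = 0.
  by apply/funext => r; rewrite fct_sumE; exact: a0.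
have := ip_sum hip a (hphi l) (hphi l k); rewrite e => /esym.
rewrite (bigD1 k) //= horth eqxx mulr1 big1 ?addr0 => [->|j /negPf jk].
  have := ip_sum hip (fun _ : 'I_0 => 0) (fun i => hphi l k) (hphi l k).
  by rewrite !big_ord0.
by rewrite horth jk mulr0.
Qed.

(** A rotation without lift is sent to the default 0, which has to act by zero; in degree 0 it would
    act by 1. *)
Lemma bform0 (K : comNzRingType) d : (0 < d)%N -> bform d (0 : 'M[K]_2) = 0.
Proof.
move=> d0; rewrite -[X in bform d X](scale0r (0 : 'M[K]_2)) bform_scale.
by rewrite expr0n gtn_eqF // scale0r.
Qed.

(* A rotation without preimage would act on the phi l m by a zero matrix, and
   invertibility of the action would make them vanish. *)
Lemma glift_SU2 l : (0 < deg l)%N -> forall Q : gmx R G, gset Q ->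
  SU2set (glift Q).
Proof.
move=> dl.
have phiN0 : exists r, phi l 0 r <> 0.
  apply: contrapT => /forallNP h.
  have := @phi_free l (fun j => (j == 0)%:R).
  have hz r : \sum_j ((j == 0)%:R : R[i]) *: phi l j r = 0.
    rewrite (bigD1 ord0) //= scale1r big1 ?addr0 => [|j /negPf ->].
      exact: contrapT (h r).
    by rewrite scale0r.
  by move=> /(_ hz 0) /eqP; rewrite eqxx oner_eq0.
case: G act hact htrans phiN0 => // act' [act1 actM] tr [r0 phir0] A SA.
rewrite /glift /lift_rotation; case: xgetP => [U -> []//|noU].
case: phir0; have SAT : SO3set A^T.
  by case: SA => AA dA; split; [rewrite trmxK; exact: mulmx1C|rewrite det_tr].
rewrite -(act1 r0) -SA.1 (actM A A^T SA SAT) tr // big1 // => j _.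
rewrite wignerD_glift /glift /lift_rotation xgetPN //.
by rewrite /wig bform0 // mulmx0 mul0mx mxE scale0r.
Qed.

Variables (N L : nat) (l : 'I_N -> J).
Hypothesis parity : ~~ odd (\sum_i deg (l i) + L).
Hypothesis N_gt0 : (0 < N)%N.
Hypothesis deg_gt0 : forall i, (0 < deg (l i))%N.

Local Notation d := (fun i => deg (l i)).
Local Notation X := {dffun forall i : 'I_N, 'I_(d i).+1}.
Local Notation TW U := (tens (fun i => wig idfun (d i) U)).
Local Notation Phi := (@product_function R F Omega J deg phi N l).

(** For SO(3), every U in SU(2) is up to sign the lift of its own rotation, and the sign does not
    matter by parity. *)
Lemma commutes_glift (c : 'M[R[i]]_(L.+1, #|{: X}|)) :
  (forall Q : gmx R G, gset Q -> commutes c (glift Q)) <->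
  (forall U, SU2set U -> commutes c U).
Proof.
have dl := deg_gt0 (Ordinal N_gt0); have SUl := glift_SU2 dl.
split=> [cQ U SU|cU Q gQ]; last exact/cU/SUl.
case: G SUl cQ => [_|_] cQ; first exact: cQ.
have [A [SA _ [e|e]]] := lift_rotation_cover SU; first by rewrite -e; exact: cQ.
by apply: (commutes_opp parity); rewrite scaleN1r -e; exact: cQ.
Qed.

Lemma sum_Phi_apply (c : X -> R[i]) r f :
  (\sum_x c x *: Phi x) r f = \sum_x c x * \prod_i f i (phi (l i) (x i) (r i)).
Proof.
rewrite (big_morph (fun h : ('I_N -> Omega) -> tensor_space F N => h r f)
  (id1 := 0) (op1 := +%R)) //.
Qed.

(** Linear forms separate F, so the scalar functions (r, f) |-> f (phi l j r) on Omega x {scalar F}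
    are still independent. *)
Lemma Phi_free (c : X -> R[i]) : \sum_x c x *: Phi x = 0 -> forall x, c x = 0.
Proof.
move=> c0; pose T := (Omega * {scalar F})%type.
apply: (@prod_free _ _ d (fun _ => T) (fun i j t => t.2 (phi (l i) j t.1))).
  move=> i a a0; apply: phi_free => r; apply: contrapT => /eqP.
  move=> /exists_scalar_neq0[f /eqP]; apply.
  rewrite raddf_sum -[RHS](a0 (r, f)) /=; apply: eq_bigr => j _.
  exact: linearZ.
move=> t; rewrite -(sum_Phi_apply c (fun i => (t i).1) (fun i => (t i).2)).
by rewrite c0.
Qed.

Definition mx_map (c : 'M[R[i]]_(L.+1, #|{: X}|)) :
    'I_L.+1 -> ('I_N -> Omega) -> tensor_space F N :=
  fun k => \sum_x c k (enum_rank x) *: Phi x.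

Lemma Phi_act (x : X) (Q : gmx R G) r : gset Q ->
  Phi x (fun i => act Q (r i)) =
  \sum_y TW (glift Q) (enum_rank x) (enum_rank y) *: Phi y r.
Proof.
move=> gQ; apply/funext => f.
rewrite (big_morph (fun h : tensor_space F N => h f) (id1 :=
  0) (op1 := +%R)) //.
rewrite /product_function /pure_tensor.
transitivity (\prod_i \sum_j wig idfun (d i) (glift Q) (x i) j *
    f i (phi (l i) j (r i))).
  apply: eq_bigr => i _; rewrite htrans // raddf_sum; apply: eq_bigr => j _.
  by rewrite wignerD_glift; exact: linearZ.
rewrite prod_sum_dffun; apply: eq_bigr => y _; rewrite big_split /=.
by rewrite mxE !enum_rankK.
Qed.

Lemma mx_map_linear a c c' : mx_map (a *: c + c') = a *: mx_map c + mx_map c'.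
Proof.
apply/funext => k; transitivity (a *: mx_map c k + mx_map c' k) => //.
rewrite /mx_map scaler_sumr -big_split; apply: eq_bigr => x _ /=.
by rewrite !mxE scalerDl scalerA.
Qed.

Lemma mx_map_eq0 (c : 'M[R[i]]_(L.+1, #|{: X}|)) : mx_map c = 0 -> c = 0.
Proof.
move=> c0; apply/matrixP => k a; rewrite mxE.
have : mx_map c k = 0 by rewrite c0.
by move/Phi_free/(_ (enum_val a)); rewrite enum_valK.
Qed.

Lemma mx_map_inj : injective mx_map.
Proof.
move=> c c' cc'; apply/eqP; rewrite -subr_eq0; apply/eqP/mx_map_eq0.
rewrite addrC -scaleN1r mx_map_linear cc' scaleN1r; exact: addNr.
Qed.

Lemma mx_mapE c k r :
  mx_map c k r = \sum_x c k (enum_rank x) *: Phi x r.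
Proof.
exact: (big_morph (fun h : ('I_N -> Omega) -> tensor_space F N => h r)
  (id1 := 0) (op1 := +%R)).
Qed.

Lemma sum_enum_rank (V : nmodType) (g : 'I_#|{: X}| -> V) :
  \sum_a g a = \sum_(x : X) g (enum_rank x).
Proof. by rewrite (reindex (@enum_rank X)) //; exact/onW_bij/enum_rank_bij. Qed.

Lemma mx_map_act c (Q : gmx R G) k r : gset Q ->
  mx_map c k (fun i => act Q (r i)) = mx_map (c *m TW (glift Q)) k r.
Proof.
move=> gQ; rewrite !mx_mapE.
transitivity (\sum_(x : X) \sum_(y : X) (c k (enum_rank x) *
    TW (glift Q) (enum_rank x) (enum_rank y)) *: Phi y r).
  apply: eq_bigr => x _; rewrite Phi_act // scaler_sumr.
  by apply: eq_bigr => y _; rewrite scalerA.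
rewrite exchange_big; apply: eq_bigr => y _.
by rewrite -scaler_suml [in RHS]mxE sum_enum_rank.
Qed.

Lemma wigner_mx_map c (Q : gmx R G) k r :
  \sum_j wignerD L Q k j *: mx_map c j r =
  mx_map (wig idfun L (glift Q) *m c) k r.
Proof.
rewrite mx_mapE.
transitivity (\sum_j \sum_(x : X)
    (wignerD L Q k j * c j (enum_rank x)) *: Phi x r).
  apply: eq_bigr => j _; rewrite mx_mapE scaler_sumr.
  by apply: eq_bigr => y _; rewrite scalerA.
rewrite exchange_big; apply: eq_bigr => x _.
by rewrite -scaler_suml [in RHS]mxE wignerD_glift.
Qed.

(** Equivariance says that two product functions with coefficient matrices c T(Q) and D(Q) c agree;
    by independence the matrices agree. *)
Lemma equivariant_mx_map f : equivariant_space act phi l (L := L) f <->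
  exists2 c, (forall U, SU2set U -> commutes c U) & f = mx_map c.
Proof.
split=> [[fV fQ]|[c /commutes_glift cQ ->]]; last first.
  split=> [k|Q gQ r k]; first by exists (fun x => c k (enum_rank x)).
  by rewrite mx_map_act // wigner_mx_map (cQ Q gQ).
have [b bP] := choice fV.
pose c : 'M[R[i]]_(L.+1, #|{: X}|) := \matrix_(k, a) b k (enum_val a).
have fc : f = mx_map c.
  apply/funext => k; rewrite bP; apply: eq_bigr => x _.
  by rewrite mxE enum_rankK.
exists c => //; apply/commutes_glift => Q gQ; apply: mx_map_inj.
apply/funext => k; apply/funext => r.
by rewrite -mx_map_act // -wigner_mx_map -fc fQ.
Qed.

Lemma dim_equivariant : exists m : nat,
  (m + weight_count d L.+2 = weight_count d L)%N /\
  has_dimension (equivariant_space act phi l (L := L)) m.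
Proof.
have [m [mE mdim]] := dim_commutant R parity; exists m; split=> //.
apply: has_dimension_image mdim; last exact: equivariant_mx_map.
- exact: mx_map_linear.
- exact: mx_map_eq0.
Qed.

End Equivariant.

(** * Comparison of antiderivatives and Taylor bounds *)

Section Calculus.
Variable R : realType.
Implicit Types (f g : R -> R) (x y t : R).

(** These rules speak of explicit functions and of products in R, so that derivatives are built by
    plain application. *)
Lemma derD f g x df dg : is_derive x 1 f df -> is_derive x 1 g dg ->
  is_derive x 1 (fun t => f t + g t) (df + dg).
Proof. by move=> *; exact: is_deriveD. Qed.

Lemma derB f g x df dg : is_derive x 1 f df -> is_derive x 1 g dg ->
  is_derive x 1 (fun t => f t - g t) (df - dg).
Proof. by move=> *; exact: is_deriveB. Qed.

Lemma derM f g x df dg : is_derive x 1 f df -> is_derive x 1 g dg ->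
  is_derive x 1 (fun t => f t * g t) (f x * dg + g x * df).
Proof. by move=> *; exact: is_deriveM. Qed.

Lemma derZ f x df (k : R) : is_derive x 1 f df ->
  is_derive x 1 (fun t => k * f t) (k * df).
Proof. by move=> *; exact: is_deriveZ. Qed.

Lemma derX x (k : nat) : is_derive x 1 (fun t : R => t ^+ k) (k%:R * x ^+ k.-1).
Proof.
have e : (k%:R * id x ^+ k.-1) *: (1 : R) = k%:R * x ^+ k.-1 by exact: mulr1.
have -> : (fun t : R => t ^+ k) = id ^+ k by rewrite exprfctE.
exact: (is_derive_eq (is_deriveX k (is_derive_id x 1)) e).
Qed.

Lemma derV f x df : f x != 0 -> is_derive x 1 f df ->
  is_derive x 1 (fun t => (f t)^-1) (- (f x) ^- 2 * df).
Proof.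
by move=> fx0 [fd fE]; apply: DeriveDef; [exact: derivableV|rewrite deriveV //
  fE].
Qed.

Lemma der_comp_mul f x (k df : R) : is_derive (k * x) 1 f df ->
  is_derive x 1 (fun t => f (k * t)) (k * df).
Proof.
move=> fd.
have kd : is_derive x 1 (fun t : R => k * t) k.
  have e : k *: (1 : R) = k by exact: mulr1.
  exact: (is_derive_eq (is_deriveZ k (is_derive_id x 1)) e).
have := @is_derive1_comp R f (fun t => k * t) x _ _ fd kd.
by rewrite mulrC.
Qed.

(* Comparing antiderivatives replaces integrating the inequality. *)
Lemma antideriv_le f g (df dg : R -> R) a b : a <= b ->
  (forall x, a <= x <= b -> is_derive x 1 f (df x)) ->
  (forall x, a <= x <= b -> is_derive x 1 g (dg x)) ->
  (forall x, a < x < b -> df x <= dg x) ->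
  f b - f a <= g b - g a.
Proof.
move=> ab fd gd fg.
have hd x : a <= x <= b -> is_derive x 1 (fun t => g t - f t) (dg x - df x).
  by move=> xab; apply: derB; [exact: gd|exact: fd].
have hc : {within `[a, b], continuous (fun t => g t - f t)}.
  apply: derivable_within_continuous => x; rewrite in_itv /= => xab.
  by have [] := hd x xab.
have e0 x : a < x < b -> derive1 (fun t => g t - f t) x = dg x - df x.
  move=> /andP[ax xb]; have xab : a <= x <= b by rewrite !ltW.
  by rewrite derive1E; have [_ ->] := hd x xab.
have := @ger0_derive1_le_cc R (fun t => g t - f t) a b.
move=> /(_ _ _ hc a b); rewrite !in_itv /= !lexx ab => /(_ _ _ isT isT isT) h.
have : g a - f a <= g b - f b.
  apply: h => x; rewrite in_itv /= => axb.
    by have /andP[ax xb] := axb; have [] := hd x (introT andP (conj (ltW ax)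
      (ltW xb))).
  by rewrite e0 // subr_ge0 fg.
by lra.
Qed.

Lemma antideriv_dist f g h (df dg dh : R -> R) a b : a <= b ->
  (forall x, a <= x <= b -> is_derive x 1 f (df x)) ->
  (forall x, a <= x <= b -> is_derive x 1 g (dg x)) ->
  (forall x, a <= x <= b -> is_derive x 1 h (dh x)) ->
  (forall x, a < x < b -> `|df x - dg x| <= dh x) ->
  `|(f b - f a) - (g b - g a)| <= h b - h a.
Proof.
move=> ab fd gd hd fgh.
have fgd x : a <= x <= b -> is_derive x 1 (fun t => f t - g t) (df x - dg x).
  by move=> xab; apply: derB; [exact: fd|exact: gd].
have gfd x : a <= x <= b -> is_derive x 1 (fun t => g t - f t) (dg x - df x).
  by move=> xab; apply: derB; [exact: gd|exact: fd].
have /(_ _) h1 := antideriv_le ab fgd hd; have /(_ _) h2 := antideriv_le ab gfd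
  hd.
rewrite ler_norml; apply/andP; split.
  suff : g b - f b - (g a - f a) <= h b - h a by lra.
  apply: h2 => x /fgh; rewrite ler_norml => /andP[]; lra.
suff : f b - g b - (f a - g a) <= h b - h a by lra.
by apply: h1 => x /fgh; rewrite ler_norml => /andP[]; lra.
Qed.

Lemma der_const (k x : R) : is_derive x 1 (fun=> k) 0.
Proof. exact: is_derive_cst. Qed.

(** The Taylor bounds of sine and cosine follow from each other by comparing antiderivatives,
    beginning with cos <= 1. *)
Lemma sin_le x : 0 <= x -> sin x <= x.
Proof.
move=> x0; have : sin x - sin 0 <= x - 0.
  apply: (@antideriv_le sin id cos (fun=> 1) _ _ x0) => t _.
  exact: cos_le1.
by rewrite sin0 !subr0.
Qed.

Lemma cos_ge x : 0 <= x -> 1 - x ^+ 2 / 2 <= cos x.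
Proof.
move=> x0; have : (- (2^-1)) * x ^+ 2 - (- (2^-1)) * 0 ^+ 2 <= cos x - cos 0.
  apply: (@antideriv_le (fun t => - (2^-1) * t ^+ 2) cos
    (fun t => - (2^-1) * (2%:R * t ^+ 1)) (fun t => - sin t) _ _ x0) => t.
  - by move=> _; apply: derZ; exact: derX.
  - by move=> /andP[t0 _]; have := sin_le (ltW t0); rewrite expr1; lra.
rewrite cos0 expr0n /=; lra.
Qed.

Lemma sin_ge x : 0 <= x -> x - x ^+ 3 / 6 <= sin x.
Proof.
move=> x0; have : (x - 6^-1 * x ^+ 3) - (0 - 6^-1 * 0 ^+ 3) <= sin x - sin 0.
  apply: (@antideriv_le (fun t => t - 6^-1 * t ^+ 3) sin
    (fun t => 1 - 6^-1 * (3%:R * t ^+ 2)) cos _ _ x0) => t.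
  - by move=> _; apply: derB; apply: derZ; exact: derX.
  - by move=> /andP[t0 _]; have := cos_ge (ltW t0); lra.
rewrite sin0 expr0n /=; lra.
Qed.

Lemma cos_le x : 0 <= x -> cos x <= 1 - x ^+ 2 / 2 + x ^+ 4 / 24.
Proof.
move=> x0.
have : cos x - cos 0 <= (- (2^-1) * x ^+ 2 + 24^-1 * x ^+ 4) -
    (- (2^-1) * 0 ^+ 2 + 24^-1 * 0 ^+ 4).
  apply: (@antideriv_le cos (fun t => - (2^-1) * t ^+ 2 + 24^-1 * t ^+ 4)
    (fun t => - sin t) (fun t => - (2^-1) * (2%:R * t ^+ 1) + 24^-1 * (4%:R * t
      ^+ 3)) _ _ x0) => t.
  - by move=> _; apply: derD; apply: derZ; exact: derX.
  - by move=> /andP[t0 _]; have := sin_ge (ltW t0); rewrite expr1; lra.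
rewrite cos0 !expr0n /=; lra.
Qed.

Lemma cos_taylor x : `|cos x - (1 - x ^+ 2 / 2)| <= x ^+ 4 / 24.
Proof.
wlog x0 : x / 0 <= x.
  move=> h; have [|x0] := lerP 0 x; first exact: h.
  have e4 : (- x) ^+ 4 = x ^+ 4 by ring.
  by have := h (- x); rewrite cosN sqrrN e4 oppr_ge0 (ltW x0); apply.
have := cos_ge x0; have := cos_le x0; have := exprn_even_ge0 (n := 4) x isT.
by rewrite ler_norml => ? ? ?; apply/andP; split; lra.
Qed.

Lemma expRN_taylor y : 0 <= y -> `|expR (- y) - (1 - y)| <= y ^+ 2 / 2.
Proof.
move=> y0; have ge1 : 1 - y <= expR (- y) by have := expR_ge1Dx (- y).
have : expR (- y) - expR (- 0) <= (2^-1 * y ^+ 2 - y) - (2^-1 * 0 ^+ 2 - 0).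
  have dN (t : R) : is_derive t 1 (fun s : R => expR (- s)) (- expR (- t)).
    have := @der_comp_mul expR t (-1) _ (is_derive_expR _).
    by under eq_fun do rewrite mulN1r; rewrite mulN1r mulN1r.
  apply: (@antideriv_le (fun t => expR (- t)) (fun t => 2^-1 * t ^+ 2 - t)
    (fun t => - expR (- t)) (fun t => 2^-1 * (2%:R * t ^+ 1) - 1) _ _ y0) => t.
  - by move=> _; apply: derB; apply: derZ; exact: derX.
  - by move=> _; have := expR_ge1Dx (- t); rewrite expr1; lra.
rewrite oppr0 expR0 expr0n /= ler_norml => h; apply/andP; split; last lra.
by have := sqr_ge0 y; lra.
Qed.

Lemma sin_mul_taylor (a t : R) : 0 <= a -> 0 <= t ->
  `|sin (a * t) * sin t - a * t ^+ 2| <= (a ^+ 3 + a) * t ^+ 4.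
Proof.
move=> a0 t0; have at0 := mulr_ge0 a0 t0.
have abs_sin x : 0 <= x -> `|sin x| <= x /\ `|sin x - x| <= x ^+ 3.
  move=> x0; have := sin_le x0; have := sin_ge x0; have := exprn_ge0 3 x0 =>
    x3 h1 h2.
  have x3' : x ^+ 3 <= 2 * x -> - x <= sin x by lra.
  have Nx : - x <= sin x.
    have [x1|x1] := lerP x 1; last by have := sin_geN1 x; lra.
    by apply: x3'; rewrite !exprS expr0 mulr1; nra.
  by split; rewrite ler_norml; apply/andP; split; lra.
have [s1 s2] := abs_sin _ at0; have [s3 s4] := abs_sin _ t0.
have -> : sin (a * t) * sin t - a * t ^+ 2 =
    (sin (a * t) - a * t) * sin t + a * t * (sin t - t) by ring.
apply: (le_trans (ler_normD _ _)); rewrite !normrM (ger0_norm a0) (ger0_norm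
  t0).
have -> : (a ^+ 3 + a) * t ^+ 4 = (a * t) ^+ 3 * t + a * t * t ^+ 3 by ring.
by apply: lerD; [exact: ler_pM|exact: ler_wpM2l].
Qed.

(** Squaring 1 + s^2 / 2 <= exp (s^2 / 2) leaves s^3 plus a positive remainder. The exponent 3 is
    chosen because t^(-3) has the antiderivative - 1 / (2 t^2), which bounds the Gaussian tail. *)
Lemma gauss_le_inv (s : R) : 0 < s -> expR (- s ^+ 2) <= (s ^+ 3)^-1.
Proof.
move=> s0; have s30 := exprn_gt0 3 s0.
rewrite expRN lef_pV2 ?posrE ?expR_gt0 //.
have e : 1 + s ^+ 2 / 2 <= expR (s ^+ 2 / 2) by have := expR_ge1Dx (s ^+ 2 / 2).
have -> : expR (s ^+ 2) = expR (s ^+ 2 / 2) ^+ 2.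
  by rewrite [RHS]expr2 -expRD; congr expR; field.
have p0 : 0 <= 1 + s ^+ 2 / 2 by have := sqr_ge0 s; lra.
apply: (@le_trans _ _ ((1 + s ^+ 2 / 2) ^+ 2));
  last by rewrite ler_pXn2r ?nnegrE ?expR_ge0.
have -> : (1 + s ^+ 2 / 2) ^+ 2 = s ^+ 3 + (1 + s ^+ 2 * (s / 2 - 1) ^+ 2) by
  field.
have : 0 <= s ^+ 2 * (s / 2 - 1) ^+ 2 by rewrite mulr_ge0 ?sqr_ge0.
by lra.
Qed.

Let mu := @lebesgue_measure R.

(* The lower bound -1 makes this differentiable at 0. *)
Definition gaussI (x : R) : R := \int[mu]_(t in `[-1, x]) gauss_fun t.

Lemma gauss_integrable (a b : R) : mu.-integrable `[a, b] (EFin \o @gauss_fun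
  R).
Proof.
apply: continuous_compact_integrable; first exact: segment_compact.
by apply: continuous_subspaceT; exact: continuous_gauss_fun.
Qed.

Lemma der_gaussI x : 0 <= x -> is_derive x 1 gaussI (expR (- x ^+ 2)).
Proof.
move=> x0; have x1 : x < x + 1 by lra.
have [] := @continuous_FTC1_closed R gauss_fun (-1) x (x + 1) x1.
- exact: gauss_integrable.
- by lra.
- exact: continuous_gauss_fun.
by move=> dF dE; apply: DeriveDef => //; rewrite -derive1E.
Qed.

Lemma gaussI_tail x : 0 < x ->
  `|gaussI x - gaussI 0 - Num.sqrt pi / 2| <= (2 * x ^+ 2)^-1.
Proof.
move=> x0.
have gI y : 0 <= y -> gaussI y - gaussI 0 =
  gauss_integral_proof.integral0_gauss y.
  move=> y0; rewrite /gaussI /gauss_integral_proof.integral0_gauss.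
  rewrite -(@Rintegral_itv_obnd_cbnd R 0 (BRight y)); last first.
    apply: integrableS (gauss_integrable 0 y) => //.
    by apply: subset_itvr; rewrite bnd_simp.
  apply: Rintegral_itvB; first exact: gauss_integrable.
    by rewrite bnd_simp; lra.
  by rewrite bnd_simp.
have x2 (y : R) : 0 < y -> (2 * y ^+ 2)^-1 = 2^-1 * (y ^+ 2)^-1.
  by move=> y0; rewrite invfM.
have step y : x <= y -> gaussI x <= gaussI y <= gaussI x + (2 * x ^+ 2)^-1.
  move=> xy; have gd t : x <= t <= y -> is_derive t 1 gaussI (expR (- t ^+ 2)).
    by move=> /andP[xt _]; apply: der_gaussI; lra.
  have h1 : gaussI x - gaussI x <= gaussI y - gaussI x.
    rewrite subrr -[0](subrr (0 : R)).
    by apply: (@antideriv_le (fun=> 0) gaussI (fun=> 0)) xy _ gd _ => t _;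
      rewrite ?expR_ge0.
  have h2 : gaussI y - gaussI x <= - 2^-1 * (y ^+ 2)^-1 - - 2^-1 * (x ^+ 2)^-1.
    apply: (@antideriv_le gaussI (fun t => - 2^-1 * (t ^+ 2)^-1) _
      (fun t => - 2^-1 * (- (t ^+ 2) ^- 2 * (2%:R * t ^+ 1)))) xy gd _ _ =>
        t /andP[xt _].
      apply: derZ; apply: derV; last exact: derX.
      by rewrite expf_neq0 // gt_eqF //; lra.
    have t0 : 0 < t by lra.
    apply: le_trans (gauss_le_inv t0) _; rewrite le_eqVlt; apply/orP; left;
      apply/eqP.
    by field; rewrite gt_eqF.
  rewrite x2 //; have y20 : 0 <= (y ^+ 2)^-1 by rewrite invr_ge0 sqr_ge0.
  by apply/andP; split; lra.
(* The known limit pi / 4 is that of the squared integral; nonnegativity allows taking the root. *)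
have lim : gaussI y - gaussI 0 @[y --> +oo] --> Num.sqrt pi / 2.
  have := @gauss_integral_proof.cvg_integral0_gauss_sqr R => h.
  have : Num.sqrt (@gauss_integral_proof.integral0_gauss R y ^+ 2) @[y --> +oo]
      --> Num.sqrt (pi / 4 : R).
    by apply: continuous_cvg; [exact: sqrt_continuous|exact: h].
  have -> : Num.sqrt (pi / 4 : R) = Num.sqrt pi / 2.
    rewrite sqrtrM ?pi_ge0 // sqrtrV // (_ : 4 = 2 ^+ 2);
      last by rewrite expr2 -natrM.
    by rewrite sqrtr_sqr ger0_norm.
  apply: cvg_trans; apply: near_eq_cvg; near=> y.
  rewrite sqrtr_sqr ger0_norm ?gauss_integral_proof.integral0_gauss_ge0 //.
  by apply/esym/gI; near: y; exact: nbhs_pinfty_ge.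
have lo : gaussI x - gaussI 0 <= Num.sqrt pi / 2.
  apply: (cvgr_to_ge lim); near=> y; rewrite lerB //.
  have /step/andP[] // : x <= y by near: y; apply: nbhs_pinfty_ge;
    exact: num_real.
have hi : Num.sqrt pi / 2 <= gaussI x - gaussI 0 + (2 * x ^+ 2)^-1.
  apply: (cvgr_to_le lim); near=> y.
  have /step/andP[_] : x <= y by near: y; apply: nbhs_pinfty_ge;
    exact: num_real.
  by lra.
by rewrite ler_norml; apply/andP; split; lra.
Unshelve. all: by end_near. Qed.

End Calculus.

(** * Normalized characters *)

Section Character.
Variable R : realType.
Implicit Types (t : R) (d : nat).

(** The character of D^(d/2) at angle 2 t, as a sum over weights, which avoids the quotient sin ((d
    + 1) t) / sin t at t = 0. *)
Definition chi d t : R := \sum_(k < d.+1) cos (((k.*2)%:R - d%:R) * t).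

Definition nchi d t : R := chi d t / d.+1%:R.

(** This is l (l + 1) / 3 at l = d / 2, the variance of a uniformly distributed weight m. *)
Definition var d : R := d%:R * (d%:R + 2) / 12.

Lemma sum_weight_sq d :
  \sum_(k < d.+1) ((k.*2)%:R - d%:R) ^+ 2 = 4 * d.+1%:R * var d :> R.
Proof.
have s1 n : \sum_(k < n) k%:R = n%:R * (n%:R - 1) / 2 :> R.
  elim: n => [|n IHn]; first by rewrite big_ord0 !mul0r.
  by rewrite big_ord_recr /= IHn -natr1; field.
have s2 n : \sum_(k < n) k%:R ^+ 2 = n%:R * (n%:R - 1) * (2 * n%:R - 1) / 6 :>
  R.
  elim: n => [|n IHn]; first by rewrite big_ord0 !mul0r.
  by rewrite big_ord_recr /= IHn -natr1; field.
transitivity (\sum_(k < d.+1) (4 * k%:R ^+ 2 - 4 * d%:R * k%:R +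
  d%:R ^+ 2) : R).
  by apply: eq_bigr => k _; rewrite -muln2 natrM; ring.
rewrite big_split /= sumrB -!mulr_sumr s1 s2 sumr_const card_ord -mulr_natl.
by rewrite /var -natr1; field.
Qed.

(** The two highest weights d and d - 2 contribute 2 cos ((d - 1) t) cos t, the other d - 1 at most
    1 each. Unlike a Taylor bound this is useful up to t = pi / 2. *)
Lemma chi_le d t : (0 < d)%N -> `|chi d t| <= 2 * `|cos t| + (d%:R - 1).
Proof.
case: d => // d _; rewrite /chi !big_ord_recr /= -addrA.
have -> : cos (((d.*2)%:R - d.+1%:R) * t) + cos (((d.+1.*2)%:R - d.+1%:R) * t) =
    2 * cos (d%:R * t) * cos t.
  have -> : ((d.*2)%:R - d.+1%:R) * t = d%:R * t - t.
    by rewrite -muln2 natrM -natr1; ring.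
  have -> : ((d.+1.*2)%:R - d.+1%:R) * t = d%:R * t + t.
    by rewrite -muln2 natrM -natr1; ring.
  by rewrite cosB cosD; ring.
rewrite [X in `|X|]addrC -[d.+1%:R in X in _ <= X]natr1 addrK;
  apply: (le_trans (ler_normD _ _)); apply: lerD.
  rewrite !normrM ger0_norm // -mulrA ler_pM2l // ler_piMl //.
  exact: cos_max.
apply: (le_trans (ler_norm_sum _ _ _)).
rewrite -[X in _ <= X%:R]card_ord -sumr_const; apply: ler_sum => k _.
exact: cos_max.
Qed.

Lemma chi_taylor d t :
  `|nchi d t - (1 - 2 * var d * t ^+ 2)| <= d%:R ^+ 4 / 24 * t ^+ 4.
Proof.
have d0 : d.+1%:R != 0 :> R by rewrite pnatr_eq0.
pose x (k : 'I_d.+1) : R := (k.*2)%:R - d%:R.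
have -> : nchi d t - (1 - 2 * var d * t ^+ 2) =
    (\sum_(k < d.+1) (cos (x k * t) - (1 - (x k * t) ^+ 2 / 2))) / d.+1%:R.
  rewrite sumrB sumrB sumr_const card_ord.
  have -> : \sum_(k < d.+1) (x k * t) ^+ 2 / 2 = 4 * d.+1%:R * var d * (t ^+
    2 / 2).
    by rewrite -sum_weight_sq mulr_suml; apply: eq_bigr => k _;
      rewrite exprMn mulrA.
  by rewrite /nchi /chi; field.
rewrite normrM normfV normr_nat ler_pdivrMr ?ltr0Sn //.
apply: (le_trans (ler_norm_sum _ _ _)).
have -> : d%:R ^+ 4 / 24 * t ^+ 4 * d.+1%:R =
    \sum_(k < d.+1) (d%:R ^+ 4 / 24 * t ^+ 4) :> R.
  by rewrite sumr_const card_ord mulr_natr.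
apply: ler_sum => k _.
apply: (le_trans (cos_taylor _)); rewrite exprMn mulrAC.
rewrite ler_wpM2r ?exprn_even_ge0 // ler_wpM2r ?invr_ge0 //.
have xd : `|x k| <= d%:R.
  have kd : (k%:R : R) <= d%:R by rewrite ler_nat -ltnS.
  have k0 : 0 <= (k%:R : R) by rewrite ler0n.
  by rewrite /x -muln2 natrM ler_norml; apply/andP; split; lra.
have -> : x k ^+ 4 = `|x k| ^+ 4 by rewrite -normrX ger0_norm // exprn_even_ge0.
by rewrite ler_pXn2r ?nnegrE.
Qed.

Lemma var_ge d : (0 < d)%N -> 4^-1 <= var d.
Proof.
move=> d0; have d1 : 1 <= (d%:R : R) by rewrite ler1n.
by rewrite /var; nra.
Qed.

Lemma var_ge0 d : 0 <= var d.
Proof. by rewrite /var !mulr_ge0 ?invr_ge0 ?ler0n // addr_ge0 ?ler0n. Qed.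

Lemma var_le d m : (d <= m)%N -> var d <= var m.
Proof.
move=> dm; have d0 : 0 <= (d%:R : R) by rewrite ler0n.
have dm' : (d%:R : R) <= m%:R by rewrite ler_nat.
by rewrite /var; nra.
Qed.

Section Uniform.
Variable m : nat.

(** On [0, pi / 2] one has cos t <= 1 - t^2 / 3, so [chi_le] yields d + 1 - 2 t^2 / 3; divide by d +
    1 <= m + 1. *)
Definition decay_rate : R := 2 / (3 * m.+1%:R).

(** The first summand comes from the cosines, the second from y^2 / 2 at y = 2 v t^2 in the
    expansion of exp (- y). *)
Definition taylor_const : R := m%:R ^+ 4 / 24 + 2 * var m ^+ 2.

Lemma decay_rate_gt0 : 0 < decay_rate.
Proof. by rewrite divr_gt0 // mulr_gt0. Qed.

Lemma nchi_le d t : (0 < d <= m)%N -> 0 <= t <= pi / 2 ->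
  `|nchi d t| <= expR (- (decay_rate * t ^+ 2)).
Proof.
move=> /andP[d0 dm] /andP[t0 tpi].
have t2 : t <= 2 by have := pihalf_lt2 R; lra.
have c0 : 0 <= cos t by apply: cos_ge0_pihalf; have := pi_gt0 R; lra.
have dpos : 0 < d.+1%:R :> R by rewrite ltr0Sn.
(* t^2 <= 4 gives t^4 / 24 <= t^2 / 6, and 1/2 - 1/6 = 1/3. *)
have ct : cos t <= 1 - t ^+ 2 / 3.
  have h := cos_le t0; have s0 := sqr_ge0 t.
  have s4 : t ^+ 2 <= 4 by rewrite expr2; nra.
  have e : t ^+ 4 = t ^+ 2 * t ^+ 2 by rewrite -exprD.
  rewrite e in h; nra.
apply: (@le_trans _ _ (1 - decay_rate * t ^+ 2)); last exact: expR_ge1Dx.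
apply: (@le_trans _ _ (1 - 2 / (3 * d.+1%:R) * t ^+ 2)).
  rewrite /nchi normrM normfV normr_nat ler_pdivrMr //.
  apply: (le_trans (chi_le t d0)); rewrite (ger0_norm c0).
  have -> : (1 - 2 / (3 * d.+1%:R) * t ^+ 2) * d.+1%:R = d.+1%:R - 2 / 3 * t ^+
    2.
    by field; rewrite gt_eqF.
  by rewrite -natr1; lra.
rewrite lerB // ler_wpM2r ?sqr_ge0 // ler_pM2l // lef_pV2 ?posrE ?mulr_gt0 //.
by rewrite ler_pM2l // ler_nat.
Qed.

Lemma decay_rate_le : (0 < m)%N -> decay_rate <= 3^-1.
Proof.
move=> m0; have m1 : 2 <= m.+1%:R :> R by rewrite ler_nat.
by rewrite /decay_rate ler_pdivrMr; lra.
Qed.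

Lemma gauss_var_le d t : (0 < d <= m)%N ->
  expR (- (2 * var d * t ^+ 2)) <= expR (- (decay_rate * t ^+ 2)).
Proof.
move=> /andP[d0 dm]; rewrite ler_expR lerN2; apply: ler_wpM2r;
  first exact: sqr_ge0.
by have := decay_rate_le (leq_trans d0 dm); have := var_ge d0; lra.
Qed.

Lemma taylor_const_ge0 : 0 <= taylor_const.
Proof.
have := sqr_ge0 (var m); have : 0 <= (m%:R : R) ^+ 4 by exact/exprn_ge0/ler0n.
by rewrite /taylor_const; lra.
Qed.

Lemma nchi_gauss d t : (d <= m)%N ->
  `|nchi d t - expR (- (2 * var d * t ^+ 2))| <= taylor_const * t ^+ 4.
Proof.
move=> dm; have v0 := var_ge0 d; have vm := var_le dm.
have y0 : 0 <= 2 * var d * t ^+ 2 by apply: mulr_ge0; [lra|exact: sqr_ge0].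
have h1 := chi_taylor d t; have h2 := expRN_taylor y0.
have t4 : 0 <= t ^+ 4 by rewrite exprn_even_ge0.
have -> : nchi d t - expR (- (2 * var d * t ^+ 2)) =
   (nchi d t - (1 - 2 * var d * t ^+ 2)) -
   (expR (- (2 * var d * t ^+ 2)) - (1 - 2 * var d * t ^+ 2)) by ring.
apply: (le_trans (ler_normB _ _)); apply: (le_trans (lerD h1 h2)).
have -> : (2 * var d * t ^+ 2) ^+ 2 / 2 = 2 * var d ^+ 2 * t ^+ 4 by field.
rewrite /taylor_const [X in _ <= X]mulrDl; apply: lerD; apply: ler_wpM2r => //.
  by apply: ler_wpM2r => //; rewrite ler_pXn2r ?nnegrE // ler_nat.
by rewrite ler_pM2l // ler_pXn2r ?nnegrE // (le_trans v0).
Qed.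

End Uniform.

(** Telescoping, one factor at a time. Measuring each difference as k q keeps all n powers of q in
    the bound. *)
Lemma dist_prod (n : nat) (u e : 'I_n -> R) (k q : R) : 0 <= q ->
  (forall i, `|u i| <= q) -> (forall i, `|e i| <= q) ->
  (forall i, `|u i - e i| <= k * q) ->
  `|\prod_i u i - \prod_i e i| <= n%:R * k * q ^+ n.
Proof.
move=> q0; elim: n u e => [|n IHn] u e uq eq ue.
  by rewrite !big_ord0 subrr normr0 !mul0r.
rewrite !big_ord_recr /=.
set U := \prod_(i < n) _; set E := \prod_(i < n) _.
have -> : U * u ord_max - E * e ord_max =
    (U - E) * u ord_max + E * (u ord_max - e ord_max) by ring.
apply: (le_trans (ler_normD _ _)); rewrite !normrM.
have Eq : `|E| <= q ^+ n.
  rewrite normr_prod -[n in q ^+ n]card_ord -prodr_const.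
  by apply: ler_prod => i _; rewrite normr_ge0 eq.
have -> : n.+1%:R * k * q ^+ n.+1 = n%:R * k * q ^+ n * q + q ^+ n * (k * q).
  by rewrite -natr1 exprS; ring.
by apply: lerD; apply: ler_pM => //; apply: IHn.
Qed.

End Character.

(** * Fourier analysis of the weight multiplicities *)

Section Fourier.
Variable R : realType.
Local Notation C := (R[i])%C.
Local Open Scope complex_scope.

Definition cexp (x : R) : C := cos x +i* sin x.

Lemma cexpD x y : cexp (x + y) = cexp x * cexp y.
Proof. by rewrite /cexp cosD sinD; simpc; rewrite [cos x * sin y + _]addrC. Qed.

Lemma cexp_sum (I : finType) (f : I -> R) :
  cexp (\sum_i f i) = \prod_i cexp (f i).
Proof.
apply: (big_morph cexp cexpD); by rewrite /cexp cos0 sin0.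
Qed.

Lemma Re_sum (I : finType) (f : I -> C) :
  complex.Re (\sum_i f i) = \sum_i complex.Re (f i).
Proof. by apply: (big_morph (@complex.Re R)) => // -[? ?] [? ?]. Qed.

Lemma Im_sum (I : finType) (f : I -> C) :
  complex.Im (\sum_i f i) = \sum_i complex.Im (f i).
Proof. by apply: (big_morph (@complex.Im R)) => // -[? ?] [? ?]. Qed.

Lemma chi_cexp d t :
  \sum_(k < d.+1) cexp (((k.*2)%:R - d%:R) * t) = (chi d t)%:C.
Proof.
apply/eqP; rewrite eq_complex Re_sum Im_sum /= eqxx /=; apply/eqP.
set s := \sum_i _; suff : s = - s by move/eqP;
  rewrite -subr_eq0 opprK -mulr2n mulrn_eq0 => /eqP.
rewrite {1}/s (reindex_inj rev_ord_inj) /= -sumrN; apply: eq_bigr => k _.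
rewrite -sinN; congr sin; rewrite subSS -mulNr; congr (_ * _).
have kd : (k <= d)%N by rewrite -ltnS.
by rewrite -!muln2 !natrM natrB //; ring.
Qed.

Section Count.
Variables (I : finType) (d : I -> nat).
Local Notation X := {dffun forall i : I, 'I_(d i).+1}.

(** The doubled weight of x relative to a. It is kept as a difference of natural numbers, both of
    them even when parity holds. *)
Definition freq (a : nat) (x : X) : R :=
  (\sum_i (x i).*2)%:R - (a + \sum_i d i)%:R.

Lemma prod_chi a t :
  (\prod_i chi (d i) t) * cos (a%:R * t) = \sum_(x : X) cos (freq a x * t).
Proof.
have e : (\prod_i chi (d i) t)%:C * cexp (- (a%:R * t)) = \sum_(x : X) cexp
  (freq a x * t).
  rewrite rmorph_prod (eq_bigr (fun i => \sum_(k < (d i).+1)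
    cexp (((k.*2)%:R - (d i)%:R) * t))) => [|i _]; last by rewrite chi_cexp.
  rewrite prod_sum_dffun mulr_suml; apply: eq_bigr => x _.
  rewrite -cexp_sum -cexpD; congr cexp; rewrite -mulr_suml -mulNr -mulrDl.
  by congr (_ * _); rewrite sumrB /freq natrD !natr_sum; ring.
have := congr1 (@complex.Re R) e; rewrite Re_sum /cexp => /= <-.
by rewrite mul0r subr0 cosN.
Qed.

Definition cosprim (z t : R) : R := if z == 0 then t else z^-1 * sin (z * t).

Lemma der_cosprim (z t : R) : is_derive t 1 (cosprim z) (cos (z * t)).
Proof.
rewrite /cosprim; case: eqP => [->|/eqP z0].
  by rewrite mul0r cos0; exact: is_derive_id.
have := derZ (z^-1) (der_comp_mul (is_derive_sin (z * t))).
by rewrite mulrA mulVf // mul1r.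
Qed.

Lemma der_sum (J : Type) (r : seq J) (f df : J -> R -> R) (t : R) :
  (forall j, is_derive t 1 (f j) (df j t)) ->
  is_derive t 1 (fun s => \sum_(j <- r) f j s) (\sum_(j <- r) df j t).
Proof.
move=> fd; elim: r => [|j r IHr].
  rewrite big_nil; under eq_fun do rewrite big_nil.
  exact: der_const.
rewrite big_cons; under eq_fun do rewrite big_cons.
exact: derD.
Qed.

Lemma sin_nat_pi (n : nat) : sin (n%:R * pi : R) = 0.
Proof.
elim: n => [|n IHn]; first by rewrite mul0r sin0.
by rewrite -natr1 mulrDl mul1r sinDpi IHn oppr0.
Qed.

(** Orthogonality of the cosines with even frequencies on [0, pi / 2]; this is where parity enters
    the count. *)
Lemma cosprim_pihalf (p q : nat) :
  cosprim ((p.*2)%:R - (q.*2)%:R) (pi / 2) = (p == q)%:R * (pi / 2) :> R.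
Proof.
rewrite /cosprim subr_eq0 eqr_nat -!muln2 eqn_mul2r /=.
case: eqP => _; first by rewrite mul1r.
have -> : ((p * 2)%:R - (q * 2)%:R) * (pi / 2) = p%:R * pi - q%:R * pi :> R.
  by rewrite !natrM; field.
by rewrite sinB !sin_nat_pi mul0r mulr0 subrr mulr0 mul0r.
Qed.

Variable L : nat.
Hypothesis parity : ~~ odd (\sum_i d i + L).

(** An explicit antiderivative of the Fourier integrand, vanishing at 0. Weights are doubled, hence
    L + 2 next to L. *)
Definition fourier (t : R) : R :=
  \sum_(x : X) (cosprim (freq L x) t - cosprim (freq L.+2 x) t).

Lemma der_fourier (t : R) : is_derive t 1 fourier
  ((\prod_i chi (d i) t) * (2 * (sin (L.+1%:R * t) * sin t))).
Proof.
have -> : 2 * (sin (L.+1%:R * t) * sin t) = cos (L%:R * t) - cos (L.+2%:R * t).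
  have -> : L%:R * t = L.+1%:R * t - t by rewrite -natr1; ring.
  have -> : L.+2%:R * t = L.+1%:R * t + t by rewrite -[L.+2%:R]natr1; ring.
  by rewrite cosB cosD; ring.
rewrite mulrBr !prod_chi -sumrB.
apply: (@der_sum _ _ (fun x t => cosprim (freq L x) t - cosprim (freq L.+2 x) t)
  (fun x t => cos (freq L x * t) - cos (freq L.+2 x * t))) => x.
exact: derB (der_cosprim _ _) (der_cosprim _ _).
Qed.

Lemma fourier_pihalf :
  fourier (pi / 2) - fourier 0 =
  ((weight_count d L)%:R - (weight_count d L.+2)%:R) * (pi / 2).
Proof.
have -> : fourier 0 = 0.
  rewrite /fourier big1 // => x _; rewrite /cosprim !mulr0 sin0 !mulr0.
  by do 2 case: ifP => _; rewrite subrr.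
have pos a : ~~ odd (\sum_i d i + a) ->
    \sum_(x : X) cosprim (freq a x) (pi / 2) = (weight_count d a)%:R * (pi / 2).
  rewrite addnC => /negPf ev; have [q qE] : exists q, (a + \sum_i d i = q.*2)%N.
    by exists (a + \sum_i d i)./2; rewrite -[LHS]odd_double_half ev.
  rewrite /weight_count -sum1_card natr_sum mulr_suml [RHS]big_mkcond /=.
  apply: eq_bigr => x _; rewrite inE /freq qE.
  have -> : (\sum_i (x i).*2 = (\sum_i x i).*2)%N.
    by rewrite (big_morph double doubleD (erefl _)).
  rewrite cosprim_pihalf -!muln2 eqn_mul2r /=.
  by case: eqP => _; rewrite ?mul1r ?mul0r.
by rewrite subr0 /fourier sumrB !pos ?mulrBl // !addnS /= negbK.
Qed.

End Count.
End Fourier.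

(** * The local limit estimate *)

Section Asymptotics.
Variable R : realType.

Lemma normr_sin_le (x : R) : 0 <= x -> `|sin x| <= x.
Proof.
move=> x0; have h := sin_le x0; rewrite ler_norml h andbT.
have [x1|x1] := lerP 1 x; first by have := sin_geN1 x; lra.
have := sin_ge x0; have : x ^+ 3 <= x by rewrite -[leRHS]expr1 ler_wiXn2l //
  ltW.
by lra.
Qed.

(** From exp y >= (1 + y / 4)^4, with 256 = 4^4 clearing the denominators. At y = c N t^2 the bound
    has an arctangent as antiderivative. *)
Lemma expRN_le_inv (y : R) : 0 <= y ->
  y ^+ 3 * expR (- y) <= 256 * (1 + y)^-1 /\
  y ^+ 2 * expR (- y) <= 256 * (1 + y)^-1.
Proof.
move=> y0; have y1 : 0 < 1 + y by lra.
have e4 : (1 + y / 4) ^+ 4 <= expR y.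
  have -> : expR y = expR (y / 4) ^+ 4 by rewrite -expRM_natl; congr expR;
    field.
  by rewrite ler_pXn2r ?nnegrE ?expR_ge0 ?expR_ge1Dx //; lra.
have key z : z * (1 + y) <= 256 * (1 + y / 4) ^+ 4 -> z * expR (- y) <=
  256 * (1 + y)^-1.
  move=> h; rewrite expRN ler_pdivrMr ?expR_gt0 // mulrAC ler_pdivlMr //.
  by apply: (le_trans h); rewrite ler_pM2l.
split; apply: key.
  have -> : 256 * (1 + y / 4) ^+ 4 = y ^+ 3 * (1 + y) +
    (15 * y ^+ 3 + 96 * y ^+ 2 + 256 * y + 256) by field.
  by rewrite lerDl !addr_ge0 ?mulr_ge0 ?exprn_ge0.
have -> : 256 * (1 + y / 4) ^+ 4 = y ^+ 2 * (1 + y) +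
  (y ^+ 4 + 15 * y ^+ 3 + 95 * y ^+ 2 + 256 * y + 256) by field.
by rewrite lerDl !addr_ge0 ?mulr_ge0 ?exprn_ge0.
Qed.

Section FixedDegrees.
Variables (m N : nat) (d : 'I_N -> nat).
Hypothesis N_gt0 : (0 < N)%N.
Hypothesis dP : forall i, (0 < d i <= m)%N.

Local Notation c := (decay_rate R m).

Definition total_var : R := \sum_i var R (d i).

Lemma m_gt0 : (0 < m)%N.
Proof. by have /andP[] := dP (Ordinal N_gt0); exact: leq_trans. Qed.

Lemma prod_nchi_dist (t : R) : 0 <= t <= pi / 2 ->
  `|\prod_i nchi (d i) t - expR (- (2 * total_var * t ^+ 2))| <=
  N%:R * (taylor_const R m * expR 2 * t ^+ 4) * expR (- (c * N%:R * t ^+ 2)).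
Proof.
move=> t0pi; have /andP[t0 tpi] := t0pi; set q := expR (- (c * t ^+ 2)).
have -> : expR (- (c * N%:R * t ^+ 2)) = q ^+ N.
  by rewrite /q -expRM_natl; congr expR; ring.
have -> : expR (- (2 * total_var * t ^+ 2)) = \prod_i expR (- (2 * var R (d
  i) * t ^+ 2)).
  by rewrite -expR_sum; congr expR;
    rewrite sumrN /total_var mulr_sumr mulr_suml.
apply: dist_prod => [|i|i|i]; first exact: expR_ge0.
- exact: nchi_le.
- by rewrite ger0_norm ?expR_ge0 //; exact: gauss_var_le.
apply: (le_trans (nchi_gauss _ (proj2 (andP (dP i))))).
(* The Taylor bound has no factor q, as [dist_prod] requires; c t^2 <= 4/3 gives 1 <= expR 2 * q,
   which supplies it. *)
have -> : taylor_const R m * expR 2 * t ^+ 4 * q = taylor_const R m * t ^+ 4 *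
  (expR 2 * q) by ring.
rewrite ler_peMr ?mulr_ge0 ?taylor_const_ge0 ?exprn_ge0 // /q -expRD.
apply: (le_trans _ (expR_ge1Dx _)); rewrite lerDl.
have t2 : t <= 2 by have := pihalf_lt2 R; lra.
have c3 := decay_rate_le R m_gt0; have c0 := decay_rate_gt0 R m.
have s4 : t ^+ 2 <= 4 by rewrite expr2; nra.
by have s0 := sqr_ge0 t; nra.
Qed.

Variable L : nat.

(** Replacing the product by the Gaussian costs N t^6, and replacing the sines by their leading term
    costs t^4. With y = c N t^2 these are y^3 / (c^3 N^2) and y^2 / (c^2 N^2), and [expRN_le_inv]
    gives the 256. *)
Definition err_const : R :=
  256 * (2 * L.+1%:R * taylor_const R m * expR 2 / c ^+ 3 + 2 * (L.+1%:R ^+ 3 +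
    L.+1%:R) / c ^+ 2).

Lemma integrand_dist (t : R) : 0 <= t <= pi / 2 ->
  `|\prod_i nchi (d i) t * (2 * (sin (L.+1%:R * t) * sin t)) -
    2 * L.+1%:R * t ^+ 2 * expR (- (2 * total_var * t ^+ 2))| <=
  err_const / N%:R ^+ 2 * (1 + c * N%:R * t ^+ 2)^-1.
Proof.
move=> t0pi; have /andP[t0 tpi] := t0pi.
set a : R := L.+1%:R; have a0 : 0 <= a by exact: ler0n.
set P := \prod_i _; set E := expR _; set S := sin _ * _.
have n0 : 0 < N%:R :> R by rewrite ltr0n.
have c0 := decay_rate_gt0 R m; have tay0 := taylor_const_ge0 R m.
set y := c * N%:R * t ^+ 2; have y0 : 0 <= y by rewrite !mulr_ge0 ?sqr_ge0 //
  ltW.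
have [y3 y2] := expRN_le_inv y0; set Q := expR (- y) in y3 y2 *.
have Q0 : 0 <= Q by exact: expR_ge0.
have EQ : E <= Q.
  rewrite /E /Q ler_expR lerN2 /y ler_wpM2r ?sqr_ge0 //.
  rewrite /total_var mulr_sumr -[X in _ * X%:R]card_ord -sumr_const mulr_sumr.
  apply: ler_sum => i _; have /andP[di dm] := dP i.
  by have := decay_rate_le R m_gt0; have := var_ge R di; lra.
have S1 : `|S| <= a * t ^+ 2.
  rewrite normrM expr2 mulrA ler_pM ?normr_sin_le ?mulr_ge0 //.
have S2 : `|S - a * t ^+ 2| <= (a ^+ 3 + a) * t ^+ 4 by exact: sin_mul_taylor.
have PE := prod_nchi_dist t0pi; rewrite -/P -/E -/y -/Q in PE.
have -> : P * (2 * S) - 2 * a * t ^+ 2 * E = 2 * ((P - E) * S) +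
  2 * (E * (S - a * t ^+ 2)).
  by ring.
apply: (@le_trans _ _ (2 * (N%:R * (taylor_const R m * expR 2 * t ^+ 4) * Q *
  (a * t ^+ 2)) +
    2 * (Q * ((a ^+ 3 + a) * t ^+ 4)))).
  apply: (le_trans (ler_normD _ _)); apply: lerD; rewrite normrM ger0_norm //
    ler_pM2l //.
    by rewrite normrM ler_pM.
  by rewrite normrM ler_pM // ger0_norm // expR_ge0.
have -> : 2 * (N%:R * (taylor_const R m * expR 2 * t ^+ 4) * Q * (a * t ^+ 2)) +
    2 * (Q * ((a ^+ 3 + a) * t ^+ 4)) =
    2 * a * taylor_const R m * expR 2 / c ^+ 3 / N%:R ^+ 2 * (y ^+ 3 * Q) +
    2 * (a ^+ 3 + a) / c ^+ 2 / N%:R ^+ 2 * (y ^+ 2 * Q).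
  by rewrite /y; field; rewrite !gt_eqF.
rewrite /err_const -/a.
have -> : 256 * (2 * a * taylor_const R m * expR 2 / c ^+ 3 + 2 * (a ^+ 3 +
  a) / c ^+ 2) / N%:R ^+ 2 * (1 + y)^-1 =
    2 * a * taylor_const R m * expR 2 / c ^+ 3 / N%:R ^+ 2 * (256 * (1 +
      y)^-1) +
    2 * (a ^+ 3 + a) / c ^+ 2 / N%:R ^+ 2 * (256 * (1 + y)^-1).
  by field; rewrite !gt_eqF //; lra.
apply: lerD; apply: ler_wpM2l => //.
  rewrite !mulr_ge0 ?invr_ge0 ?exprn_ge0 ?expR_ge0 ?(ltW c0) //.
have a3 : 0 <= a ^+ 3 + a by rewrite addr_ge0 ?exprn_ge0.
by rewrite !divr_ge0 ?exprn_ge0 ?(ltW c0) // mulr_ge0.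
Qed.

(** Integration by parts reduces t^2 exp (- b t^2) to a Gaussian, and scaling by sqrt b expresses
    its antiderivative by [gaussI]. *)
Definition gauss_prim (t : R) : R :=
  let b := 2 * total_var in
  2 * L.+1%:R * (- (2 * b)^-1 * (t * expR (- (b * t ^+ 2))) +
    (2 * b * Num.sqrt b)^-1 * gaussI (Num.sqrt b * t)).

Lemma total_var_ge : N%:R / 4 <= total_var.
Proof.
have -> : N%:R / 4 = \sum_(i < N) 4^-1 :> R by rewrite sumr_const card_ord
  mulr_natl.
by apply: ler_sum => i _; have /andP[di _] := dP i; exact: var_ge.
Qed.

Lemma der_gauss_prim (t : R) : 0 <= t -> is_derive t 1 gauss_prim
  (2 * L.+1%:R * t ^+ 2 * expR (- (2 * total_var * t ^+ 2))).
Proof.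
move=> t0; have n0 : 0 < N%:R :> R by rewrite ltr0n.
have b0 : 0 < 2 * total_var by have := total_var_ge; lra.
rewrite /gauss_prim; set b := 2 * total_var in b0 *.
have s0 : 0 < Num.sqrt b by rewrite sqrtr_gt0.
have sb : Num.sqrt b ^+ 2 = b by rewrite sqr_sqrtr // ltW.
have dE : is_derive t 1 (fun s : R => expR (- (b * s ^+ 2)))
    (expR (- (b * t ^+ 2)) * (- b * (2%:R * t ^+ 1))).
  have h : is_derive t 1 (fun s : R => - b * s ^+ 2) (- b * (2%:R * t ^+ 1)).
    exact/derZ/derX.
  have := @is_derive1_comp R expR (fun s => - b * s ^+ 2) t _ _ (is_derive_expR
    _) h.
  rewrite mulNr => e; have -> : (fun s : R => expR (- (b * s ^+ 2))) =
    expR \o (fun s => - b * s ^+ 2).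
    by apply/funext => s /=; rewrite mulNr.
  exact: e.
have dG := der_comp_mul (der_gaussI (mulr_ge0 (ltW s0) t0)).
have := derZ (2 * L.+1%:R) (derD (derZ (- (2 * b)^-1) (derM (is_derive_id t 1)
  dE))
   (derZ (2 * b * Num.sqrt b)^-1 dG)).
rewrite exprMn sb => /is_derive_eq; apply.
by rewrite /= expr1; field; rewrite !gt_eqF.
Qed.

(** The boundary term and the Gaussian tail at pi / 2 >= 1 together cost 3/2 (L + 1) b^(-5/2), and b
    >= N / 2 turns this into 12 (L + 1) N^(-5/2). *)
Lemma gauss_prim_pihalf :
  `|gauss_prim (pi / 2) - gauss_prim 0 -
    L.+1%:R * Num.sqrt pi / (2 * (2 * total_var) * Num.sqrt (2 * total_var))| <=
  12 * L.+1%:R / (N%:R ^+ 2 * Num.sqrt N%:R).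
Proof.
have n0 : 0 < N%:R :> R by rewrite ltr0n.
have Vge := total_var_ge; rewrite /gauss_prim; set b := 2 * total_var.
have bN : N%:R / 2 <= b by rewrite /b; lra.
have b0 : 0 < b by lra.
clearbody b.
set sb := Num.sqrt b; have s0 : 0 < sb by rewrite sqrtr_gt0.
have sb2 : sb ^+ 2 = b by rewrite sqr_sqrtr // ltW.
have b0' := ltW b0; have s0' := ltW s0.
set a : R := L.+1%:R; have a0 : 0 <= a by exact: ler0n.
move: (pi / 2) (pihalf_ge1 R) => T T1.
have sT : 0 < sb * T by rewrite mulr_gt0 //; lra.
have tail := gaussI_tail sT; set D := gaussI (sb * T) - gaussI 0 - _ in tail.
have gle := gauss_le_inv sT; set E := expR _ in gle.
have E0 : 0 <= E by exact: expR_ge0.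
have bE : b * T ^+ 2 = (sb * T) ^+ 2 by rewrite exprMn sb2.
rewrite bE -/E mul0r !mulr0.
have -> : 2 * a * (- (2 * b)^-1 * (T * E) + (2 * b * sb)^-1 * gaussI (sb * T)) -
    2 * a * (0 + (2 * b * sb)^-1 * gaussI 0) - a * Num.sqrt pi / (2 * b * sb) =
    2 * a * (- ((2 * b)^-1 * (T * E)) + (2 * b * sb)^-1 * D).
  by rewrite /D; field; rewrite !gt_eqF.
have b2s0 : 0 < b ^+ 2 * sb by rewrite mulr_gt0 ?exprn_gt0.
have T2 : (T ^+ 2)^-1 <= 1 by rewrite invf_le1 ?exprn_ege1 // exprn_gt0 //; lra.
have k1 : (2 * b)^-1 * (T * E) <= (2 * (b ^+ 2 * sb))^-1.
  apply: (@le_trans _ _ ((2 * b)^-1 * (T * ((sb * T) ^+ 3)^-1))).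
    apply: ler_wpM2l; first by rewrite invr_ge0; lra.
    by apply: ler_wpM2l => //; lra.
  have -> : (2 * b)^-1 * (T * ((sb * T) ^+ 3)^-1) = (2 * (b ^+ 2 * sb))^-1 * (T
    ^+ 2)^-1.
    have -> : (sb * T) ^+ 3 = b * sb * T ^+ 3 by rewrite -sb2; ring.
    by field; rewrite !gt_eqF //; lra.
  by apply: ler_piMr => //; rewrite invr_ge0 mulr_ge0 // ltW.
have k2 : (2 * b * sb)^-1 * `|D| <= (4 * (b ^+ 2 * sb))^-1.
  apply: (@le_trans _ _ ((2 * b * sb)^-1 * (2 * (sb * T) ^+ 2)^-1)).
    by apply: ler_wpM2l => //; rewrite invr_ge0 !mulr_ge0.
  have -> : (2 * b * sb)^-1 * (2 * (sb * T) ^+ 2)^-1 = (4 * (b ^+ 2 * sb))^-1 *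
    (T ^+ 2)^-1.
    by rewrite exprMn sb2; field; rewrite !gt_eqF //; lra.
  by apply: ler_piMr => //; rewrite invr_ge0 mulr_ge0 // ltW.
have TE0 : 0 <= (2 * b)^-1 * (T * E).
  by rewrite mulr_ge0 ?invr_ge0 ?mulr_ge0 //; lra.
rewrite normrM ger0_norm ?mulr_ge0 //.
(* Here sqrt (N / 2) is weakened to sqrt (N / 4) = sqrt N / 2, which keeps the constant 8
   rational. *)
have k3 : (b ^+ 2 * sb)^-1 <= 8 / (N%:R ^+ 2 * Num.sqrt N%:R).
  have sN0 : 0 < Num.sqrt N%:R :> R by rewrite sqrtr_gt0.
  have NN : 0 < N%:R ^+ 2 * Num.sqrt N%:R :> R by rewrite mulr_gt0 ?exprn_gt0.
  rewrite -[8]invrK -invfM lef_pV2 ?posrE ?mulr_gt0 ?invr_gt0 //.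
  have -> : 8^-1 * (N%:R ^+ 2 * Num.sqrt N%:R) = (N%:R / 2) ^+ 2 * (Num.sqrt
    N%:R / 2) :> R.
    by field.
  apply: ler_pM; rewrite ?exprn_ge0 ?divr_ge0 ?sqrtr_ge0 //.
    by rewrite ler_pXn2r ?nnegrE ?divr_ge0 // ltW.
  have -> : Num.sqrt N%:R / 2 = Num.sqrt (N%:R / 4) :> R.
    rewrite sqrtrM ?ler0n // sqrtrV // (_ : 4 = 2 ^+ 2);
      last by rewrite expr2 -natrM.
    by rewrite sqrtr_sqr ger0_norm.
  by rewrite ler_wsqrtr //; lra.
apply: (@le_trans _ _ (2 * a * ((2 * (b ^+ 2 * sb))^-1 +
  (4 * (b ^+ 2 * sb))^-1))).
  apply: ler_wpM2l; first by rewrite mulr_ge0.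
  apply: (le_trans (ler_normD _ _)); rewrite normrN ger0_norm // lerD //.
  by rewrite normrM ger0_norm ?invr_ge0 ?mulr_ge0 // ltW.
have -> : 2 * a * ((2 * (b ^+ 2 * sb))^-1 + (4 * (b ^+ 2 * sb))^-1) =
    3 / 2 * a * (b ^+ 2 * sb)^-1.
  by field; rewrite !gt_eqF.
have -> : 12 * a / (N%:R ^+ 2 * Num.sqrt N%:R) =
    3 / 2 * a * (8 / (N%:R ^+ 2 * Num.sqrt N%:R)).
  by field; rewrite !gt_eqF // sqrtr_gt0.
by apply: ler_wpM2l => //; rewrite !mulr_ge0.
Qed.

Hypothesis parity : ~~ odd (\sum_i d i + L).

Lemma count_dist :
  `|((weight_count d L)%:R - (weight_count d L.+2)%:R) / \prod_i (d i).+1%:R -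
    L.+1%:R / (2 * Num.sqrt (2 * pi) * (total_var * Num.sqrt total_var))| <=
  (err_const * (pi / 2) / Num.sqrt c + 12 * L.+1%:R) / (N%:R ^+ 2 * Num.sqrt
    N%:R).
Proof.
have n0 : 0 < N%:R :> R by rewrite ltr0n.
have c0 := decay_rate_gt0 R m.
have V0 : 0 < total_var by have := total_var_ge; lra.
have T1 : 1 <= pi / 2 :> R := pihalf_ge1 R.
have T0 : 0 <= pi / 2 :> R by lra.
set W := \prod_i _; have W0 : W != 0.
  by rewrite prodf_seq_neq0; apply/allP => i _ /=; rewrite pnatr_eq0.
set n' := _ / W; set a : R := L.+1%:R.
set s : R := Num.sqrt (c * N%:R); have cN0 : 0 < c * N%:R by rewrite mulr_gt0.
have s0 : 0 < s by rewrite sqrtr_gt0.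
have s2 : s ^+ 2 = c * N%:R by rewrite sqr_sqrtr // ltW.
set M := err_const / N%:R ^+ 2.
have Fd (t : R) : 0 <= t <= pi / 2 -> is_derive t 1 (fun t => W^-1 * fourier d
  L t)
    (\prod_i nchi (d i) t * (2 * (sin (a * t) * sin t))).
  move=> _; have := derZ W^-1 (@der_fourier R _ d L t).
  by rewrite mulrA /nchi prodf_div -/W [_ / W]mulrC.
have Gd (t : R) : 0 <= t <= pi / 2 -> is_derive t 1 gauss_prim
    (2 * a * t ^+ 2 * expR (- (2 * total_var * t ^+ 2))).
  by move=> /andP[t0 _]; exact: der_gauss_prim.
(* With s^2 = c N the arctangent is at most pi / 2, and the factor 1 / s supplies the last N^(-1/2)
   of the error. *)
have Hd (t : R) : 0 <= t <= pi / 2 -> is_derive t 1 (fun t => M * s^-1 * atan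
  (s * t))
    (M * (1 + c * N%:R * t ^+ 2)^-1).
  move=> _; have := derZ (M * s^-1) (der_comp_mul (is_derive1_atan (s * t))).
  by rewrite exprMn s2 -!mulrA mulKf // gt_eqF.
have := antideriv_dist T0 Fd Gd Hd.
have fgh t : 0 < t < pi / 2 ->
    `|\prod_i nchi (d i) t * (2 * (sin (a * t) * sin t)) -
      2 * a * t ^+ 2 * expR (- (2 * total_var * t ^+ 2))| <=
    M * (1 + c * N%:R * t ^+ 2)^-1.
  by move=> /andP[t0 t1]; apply: integrand_dist; rewrite !ltW.
move=> /(_ fgh); rewrite mulr0 atan0 mulr0 subr0 -mulrBr (@fourier_pihalf R _ d
  L parity).
rewrite (_ : W^-1 * _ = n' * (pi / 2)); last by rewrite /n'; field.
move=> dist.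
have gp := gauss_prim_pihalf; rewrite -/a in gp.
set K := a * Num.sqrt pi / _ in gp.
have M0 : 0 <= M.
  have c1 := ltW c0; have a0 : 0 <= a := ler0n R L.+1.
  have h1 : 0 <= 2 * a * taylor_const R m * expR 2 by rewrite !mulr_ge0
    ?taylor_const_ge0 ?expR_ge0.
  have h2 : 0 <= 2 * (a ^+ 3 + a) by rewrite mulr_ge0 // addr_ge0 ?exprn_ge0.
  apply: divr_ge0; last exact: exprn_ge0.
  by apply: mulr_ge0 => //; apply: addr_ge0; apply: divr_ge0;
    rewrite ?exprn_ge0.
have hb : M * s^-1 * atan (s * (pi / 2)) <=
    err_const * (pi / 2) / Num.sqrt c / (N%:R ^+ 2 * Num.sqrt N%:R).
  apply: (@le_trans _ _ (M * s^-1 * (pi / 2))).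
    apply: ler_wpM2l; last exact/ltW/atan_ltpi2.
    by apply: mulr_ge0 => //; rewrite invr_ge0 ltW.
  rewrite /M /s sqrtrM ?(ltW c0) // le_eqVlt; apply/orP; left; apply/eqP.
  by field; rewrite !gt_eqF // sqrtr_gt0.
(* Uses sqrt pi = pi / sqrt pi; the factor pi / 2 is split off because the Fourier integral yields
   the count times pi / 2. *)
have KE : K = a / (2 * Num.sqrt (2 * pi) * (total_var * Num.sqrt total_var)) *
  (pi / 2).
  have p0 : 0 < Num.sqrt pi :> R by rewrite sqrtr_gt0 pi_gt0.
  have v0 : 0 < Num.sqrt total_var by rewrite sqrtr_gt0.
  have r0 : 0 < Num.sqrt 2 :> R by rewrite sqrtr_gt0.
  rewrite /K !sqrtrM // -[X in _ = _ * (X / 2)](sqr_sqrtr (pi_ge0 R)).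
  by field; rewrite !gt_eqF.
set main := a / _ in KE *.
have tot : `|n' * (pi / 2) - main * (pi / 2)| <=
    (err_const * (pi / 2) / Num.sqrt c + 12 * a) / (N%:R ^+ 2 * Num.sqrt N%:R).
  rewrite -KE [X in _ <= X]mulrDl.
  have -> : n' * (pi / 2) - K = (n' * (pi / 2) - (gauss_prim (pi / 2) -
    gauss_prim 0)) +
      (gauss_prim (pi / 2) - gauss_prim 0 - K) by ring.
  apply: (le_trans (ler_normD _ _)); apply: lerD => //.
  exact: le_trans dist hb.
(* The common factor pi / 2 is at least 1, so dropping it only decreases the left side. *)
apply: le_trans tot; rewrite -mulrBl normrM [`|pi / 2|]ger0_norm //.
by rewrite ler_peMr.
Qed.

End FixedDegrees.
End Asymptotics.

(** * Half-integral degrees and the dimension estimate *)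

Section Parity.
Variable R : realType.

Lemma even_of_half_int (n : nat) : (n%:R / 2 : R) \is a Num.int -> ~~ odd n.
Proof.
move=> /intrP[z zE]; have e : n%:Z = (z * 2)%R.
  apply: (@intr_inj R); rewrite rmorphM /= -zE.
  by rewrite pmulrn; field.
apply/negP => on; have := congr1 absz e; rewrite abszM /= => {}e.
by move: on; rewrite e oddM andbF.
Qed.

End Parity.

Theorem proposition3p13
  (R : realType) (G : rotgroup)
  (Omega : Type) (act : gmx R G -> Omega -> Omega)
  (hact : group_action act)
  (F : lmodType R[i])
  (H : set (Omega -> F)) (ip : (Omega -> F) -> (Omega -> F) -> R[i])
  (hip : inner_product_on H ip)
  (I : Type) (deg : I -> nat) (hdeg : forall l, is_degree G (deg l))
  (phi : forall l : I, 'I_(deg l).+1 -> Omega -> F)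
  (hphi : forall l m, H (phi l m))
  (horth : forall l m m', ip (phi l m) (phi l m') = (m == m')%:R)
  (htrans : forall l m Q, gset Q -> forall r,
     phi l m (act Q r) = \sum_m' wignerD (deg l) Q m m' *: phi l m' r)
  (L : nat) (hL : is_degree G L)
  (lmin lmax : R) (hlmin : 0 < lmin) (hlmax : 0 < lmax)
  (kappa : R) (hkappa : 0 < kappa) :
  exists (C : R) (N0 : nat), forall (N : nat) (l : 'I_N -> I),
    let ell := fun i : 'I_N => ell_of R (deg (l i)) in
    (N0 <= N)%N ->
    (ell_of R L + \sum_(i < N) ell i) \is a Num.int ->
    (forall i, lmin <= ell i <= lmax) ->
    ell_of R L <= kappa * Num.sqrt (Var ell) ->
    exists (n : nat) (e : R),
      [/\ has_dimension (equivariant_space act phi l (L := L)) n,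
          `|e| <= C / (N%:R `^ (5 / 2)) &
          n%:R = (\prod_(i < N) (2 * ell i + 1)) *
            ((2 * ell_of R L + 1) /
               (2 * Num.sqrt (2 * pi) * (Var ell) `^ (3 / 2)) + e)].
Proof.
have [m mP] : exists m : nat, 2 * lmax <= m%:R.
  by exists (Num.truncn (2 * lmax)).+1; rewrite ltW // truncnS_gt.
(* Every doubled degree 2 ell is at most m; the constant is that of [count_dist], valid for every N
   >= 1. *)
exists (err_const R m L * (pi / 2) / Num.sqrt (decay_rate R m) +
  12 * L.+1%:R), 1%N.
move=> N l ell N1 Lint ellP _; pose d i := deg (l i).
have ellE i : ell i = (d i)%:R / 2 by [].
(* [lmin] > 0 excludes degree 0, so each factor adds at least 1/4 to the variance. *)
have dP i : (0 < d i <= m)%N.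
  have /andP[lo hi] := ellP i; rewrite ellE in lo hi; apply/andP; split.
    by rewrite -(ltr_nat R); lra.
  by rewrite -(ler_nat R); lra.
have parity : ~~ odd (\sum_i d i + L).
  apply: (@even_of_half_int R); rewrite natrD natr_sum mulrDl mulr_suml addrC.
  exact: Lint.
have [n [nE ndim]] := dim_equivariant hact hip hphi horth htrans parity N1
  (fun i => proj1 (andP (dP i))).
have VarE : Var ell = total_var R d.
  by apply: eq_bigr => i _; rewrite ellE /var; field.
have prodE : \prod_(i < N) (2 * ell i + 1) = \prod_i (d i).+1%:R.
  by apply: eq_bigr => i _; rewrite ellE -natr1; field.
have W0 : \prod_i (d i).+1%:R != 0 :> R.
  by rewrite prodf_seq_neq0; apply/allP => i _ /=; rewrite pnatr_eq0.
have V0 : 0 < total_var R d.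
  have := @total_var_ge R m N d dP; have : 0 < N%:R :> R by rewrite ltr0n.
  by lra.
have N0 : 0 < N%:R :> R by rewrite ltr0n.
have powE (x : R) (k : nat) : 0 < x -> x `^ (k.*2.+1%:R / 2) =
  x ^+ k * Num.sqrt x.
  move=> x0; have -> : k.*2.+1%:R / 2 = k%:R + 2^-1 :> R.
    by rewrite -muln2 -natr1 natrM; field.
  by rewrite powRD ?gt_eqF ?implybT // powR_mulrn ?powR12_sqrt // ltW.
have V32 : total_var R d `^ (3 / 2) = total_var R d * Num.sqrt (total_var R d).
  exact: (powE _ 1%N V0).
have N52 : N%:R `^ (5 / 2) = N%:R ^+ 2 * Num.sqrt N%:R :> R.
  exact: (powE _ 2%N N0).
have main := @count_dist R m N d N1 dP L parity.
have nR : n%:R = (weight_count d L)%:R - (weight_count d L.+2)%:R :> R.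
  by rewrite -nE natrD addrK.
(* The error term is the exact remainder, so only its size has to be bounded. *)
exists n, (n%:R / \prod_i (d i).+1%:R - (2 * ell_of R L + 1) /
  (2 * Num.sqrt (2 * pi) * (Var ell) `^ (3 / 2))); split=> //.
  have -> : 2 * ell_of R L + 1 = L.+1%:R by rewrite /ell_of -natr1; field.
  by rewrite nR N52 VarE V32.
by rewrite prodE addrC subrK mulrC divfK.
Qed.
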